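(* Let $D$ be a planar knotoid diagram. Then $H_D(t,y,z)$ is an invariant: if $D$ and $D'$ are equivalent planar knotoid diagrams (that is, they represent the same planar knotoid), then $H_D(t,y,z)=H_{D'}(t,y,z)$.
   Context: **Planar knotoid diagrams.** A planar knotoid diagram $D$ is a generic immersion of the oriented interval $[0,1]$ into $\mathbb{R}^2$ with finitely many transverse double points (crossings), each carrying over/under information. It is oriented from $0$ to $1$. The images of $0$ and $1$ are the tail and the head; they are distinct from the double points. The sign $\operatorname{sgn}(c)=\pm1$ of a crossing $c$ is the usual one: $+1$ if the over-strand direction is rotated counterclockwise (by less than $\pi$) to the under-strand direction, and $-1$ otherwise. Two diagrams are equivalent if they are related by a finite sequence of planar isotopies and oriented Reidemeister moves $\Omega_1,\Omega_2,\Omega_3$ performed away from the tail and head; pulling an endpoint over or under an arc is forbidden. Equivalence classes are planar knotoids. **Gauss diagram.** $G(D)$ is a counterclockwise oriented arc of a circle (the circle minus a gap between head and tail), running from the tail to the head, with a chord joining the two preimages of each crossing. Each chord $c$ is directed from the overcrossing to the undercrossing and carries the sign $\operatorname{sgn}(c)$ of its crossing. $C(G(D))$ is the set of chords. For a chord $c$, let $r(c)$ (resp. $\ell(c)$) be the set of chords $e\ne c$ intersecting $c$ and passing through $c$ from left to right (resp. from right to left) with respect to the direction of $c$, where $e$ is traversed in its own direction. Thus $e\in r(c)$ means that the starting point of $e$ is on the left of $c$ and its end point on the right. Let $r^{\pm}(c)$ and $\ell^{\pm}(c)$ be the subsets of chords of sign $\pm$. **Degree.** $d(c)=|r^+(c)|-|r^-(c)|-|\ell^+(c)|+|\ell^-(c)|$.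 **Index functions.** For a chord $c$ put $R_{|d(c)|}=\mathbb{Z}[z^{\pm1}]/(z^{|d(c)|}-1)$ (so $R_0=\mathbb{Z}[z^{\pm1}]$ and $R_1=\mathbb{Z}$), and $\phi_c(k)=k \bmod |d(c)|$, with $\phi_c=\mathrm{id}$ if $d(c)=0$. For $n\in\mathbb{N}=\{0,1,2,\dots\}$ let $r^n(c)=\{e\in r(c):\gcd(d(c),d(e))=n\}$ and $\ell^n(c)=\{e\in\ell(c):\gcd(d(c),d(e))=n\}$, where $\gcd(a,0)=|a|$ and $\gcd(0,0)=0$. The $n$-th index function is $$\operatorname{Ind}_c^n(z)=\sum_{e\in r^n(c)}\operatorname{sgn}(e)\,z^{\phi_c(d(e))}-\sum_{e\in\ell^n(c)}\operatorname{sgn}(e)\,z^{\phi_c(-d(e))}\in R_{|d(c)|}.$$ **The function $H_D$.** $$H_D(t,y,z)=\sum_{c\in C(G(D)),\,n\in\mathbb{N}}\operatorname{sgn}(c)\left(t^{\operatorname{Ind}_c^n(z)}-1\right)y^n,$$ a finite sum since $\operatorname{Ind}_c^n(z)\neq0$ for only finitely many pairs $(c,n)$. Here $t^f$ (for $f\in R_k$, $k\ge0$) is a formal symbol, with $t^0=1$ for the zero of every $R_k$. So $H_D$ is a polynomial in $y$ with coefficients in the free abelian group on the symbols $t^f$, where $f$ runs over the disjoint union of the $R_k$ ($k\geq 0$) with all zero elements identified. *)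

(* Defs.v *)
From HB Require Import structures.
From mathcomp Require Import all_boot all_order all_algebra all_fingroup finmap.
From mathcomp Require Import generic_quotient.
From mathcomp Require Import all_classical all_reals all_analysis.
From mathcomp.multinomials Require monalg.
From Stdlib Require Import Relation_Operators.

Set Implicit Arguments.
Unset Strict Implicit.
Unset Printing Implicit Defensive.

(* The notations of monalg clash with those of analysis. *)
Import -(notations) monalg.
Import Order.TTheory GRing.Theory Num.Theory.
Import numFieldNormedType.Exports.

Local Open Scope classical_set_scope.
Local Open Scope quotient_scope.
Local Open Scope ring_scope.

(** * Planar knotoid diagrams *)

(* Class C^n. On a finite-dimensional V, f is C^{n+1} iff it is differentiable
   and all its directional derivatives are C^n. *)
Fixpoint Cn (R : realType) (V W : normedModType R) (n : nat) (f : V -> W) :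
    Prop :=
  if n is m.+1
  then (forall x, differentiable f x) /\ (forall v, Cn m ('D_v f))
  else continuous f.

Definition smooth (R : realType) (V W : normedModType R) (f : V -> W) : Prop :=
  forall n, Cn n f.

Definition det2 (R : realType) (v w : R * R) : R := v.1 * w.2 - v.2 * w.1.

(* Ordered pairs of distinct parameters in [0, 1] with the same image; every
   double point of the curve contributes two of them. *)
Definition double_pairs (R : realType) (g : R -> R * R) : set (R * R) :=
  [set p | [/\ 0 <= p.1 <= 1, 0 <= p.2 <= 1, p.1 != p.2 & g p.1 = g p.2]].

(* A smooth map on the closed interval [0, 1] is the restriction of a smooth map
   on the line, so the curve is given by such an extension; all other conditions
   bear on [0, 1]. [is_over t] tells whether the passage at time t is the
   over-passage of its crossing; its value is irrelevant when the point at time t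
   is not a double point. *)
Record diagram (R : realType) := Diagram {
  curve :> R -> R * R;
  is_over : R -> bool;
  curve_smooth : smooth curve;
  curve_immersed : forall t, 0 <= t <= 1 -> derive1 curve t != 0;
  curve_finite : finite_set (double_pairs curve);
  curve_double : forall s t u,
    double_pairs curve (s, t) -> double_pairs curve (s, u) -> t = u;
  curve_transverse : forall s t,
    double_pairs curve (s, t) -> det2 (derive1 curve s) (derive1 curve t) != 0;
  curve_ends : forall s t, double_pairs curve (s, t) -> 0 < s < 1;
  over_under : forall s t, double_pairs curve (s, t) -> is_over s = ~~ is_over t
}.

(** * Planar isotopy and Reidemeister moves *)

(* [h] is a smooth ambient isotopy of the plane; [phi] is an orientation
   preserving reparametrization of [0, 1]. *)
Definition planar_isotopic (R : realType) (D D' : diagram R) : Prop :=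
  exists (h : R * (R * R) -> R * R) (phi : R -> R),
  [/\ smooth h,
      forall p, h (0, p) = p,
      forall tau, 0 <= tau <= 1 -> exists k : R * R -> R * R,
        [/\ smooth k, cancel (fun p => h (tau, p)) k
          & cancel k (fun p => h (tau, p))],
      [/\ smooth phi, phi 0 = 0, phi 1 = 1
        & forall t, 0 <= t <= 1 -> 0 < derive1 phi t]
    & (forall t, 0 <= t <= 1 -> D' (phi t) = h (1, D t)) /\
      (forall s t, double_pairs D (s, t) -> is_over D' (phi s) = is_over D s)].

(* The Reidemeister moves are performed in the following fixed disc: a planar
   isotopy carries any other disc to it, and brings the arcs in it to the
   position required below. *)
Definition box (R : realType) : set (R * R) :=
  [set p | `|p.1| <= 1 /\ `|p.2| <= 1].

(* The part of D in the box consists of the k arcs D([a i, b i]). They avoid the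
   tail and the head. *)
Definition box_arcs (R : realType) (k : nat) (a b : 'I_k -> R) (D : diagram R) :
    Prop :=
  [/\ forall i, [/\ 0 < a i, a i < b i & b i < 1],
      forall i j, i != j -> b i < a j \/ b j < a i
    & forall t, 0 <= t <= 1 ->
        (@box R (D t) <-> exists i, a i <= t <= b i)].

(* Each arc is the graph of a function over the horizontal axis, joining the two
   vertical sides of the box, in either direction. *)
Definition graph_arcs (R : realType) (k : nat) (a b : 'I_k -> R)
    (D : diagram R) : Prop :=
  forall i, [/\ `|(D (a i)).1| = 1, `|(D (b i)).1| = 1
    & forall t, a i <= t <= b i -> (derive1 D t).1 != 0 /\ `|(D t).2| < 1].

Definition box_replacement (R : realType) (k : nat) (a b : 'I_k -> R)
    (D D' : diagram R) : Prop :=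
  [/\ box_arcs a b D, box_arcs a b D'
    & forall t, 0 <= t <= 1 -> (forall i, ~ (a i <= t <= b i)) ->
        D' t = D t /\ is_over D' t = is_over D t].

(* Crossings of the arcs i and j, as pairs of parameters. *)
Definition arc_crossings (R : realType) (k : nat) (a b : 'I_k -> R)
    (D : diagram R) (i j : 'I_k) : set (R * R) :=
  [set p | [/\ double_pairs D p, a i <= p.1 <= b i & a j <= p.2 <= b j]].

(* An arc without self-crossing is replaced by an arc with one self-crossing. *)
Definition Omega1 (R : realType) (D D' : diagram R) : Prop :=
  exists a b : 'I_1 -> R,
  [/\ box_replacement a b D D',
      arc_crossings a b D ord0 ord0 = set0
    & exists s u, s != u /\
        arc_crossings a b D' ord0 ord0 = [set (s, u); (u, s)]].

(* Two disjoint arcs are replaced by two arcs crossing twice, one of which is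
   over the other at both crossings. *)
Definition Omega2 (R : realType) (D D' : diagram R) : Prop :=
  exists a b : 'I_2 -> R,
  [/\ box_replacement a b D D', graph_arcs a b D, graph_arcs a b D',
      arc_crossings a b D ord0 ord_max = set0
    & exists p q : R * R, [/\ p != q,
        arc_crossings a b D' ord0 ord_max = [set p; q]
      & is_over D' p.1 = is_over D' q.1]].

(* [p i j] is the parameter on the arc i of its unique crossing with the arc j.
   The heights [lev i] tell which arc is over which. *)
Definition triangle (R : realType) (a b : 'I_3 -> R) (lev : {perm 'I_3})
    (p : 'I_3 -> 'I_3 -> R) (D : diagram R) : Prop :=
  forall i j, i != j ->
    arc_crossings a b D i j = [set (p i j, p j i)] /\
    is_over D (p i j) = (lev j < lev i)%N.

(* Three arcs at three different heights, crossing pairwise once; from left to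
   right, the crossings are 01, 02, 12 before the move and 12, 02, 01 after it,
   as in the braid relation. *)
Definition Omega3 (R : realType) (D D' : diagram R) : Prop :=
  let i0 : 'I_3 := inord 0 in let i1 : 'I_3 := inord 1 in
  let i2 : 'I_3 := inord 2 in
  exists (a b : 'I_3 -> R) (lev : {perm 'I_3}) (p q : 'I_3 -> 'I_3 -> R),
  [/\ [/\ box_replacement a b D D', graph_arcs a b D & graph_arcs a b D'],
      triangle a b lev p D,
      triangle a b lev q D',
      (D (p i0 i1)).1 < (D (p i0 i2)).1 < (D (p i1 i2)).1
    & (D' (q i1 i2)).1 < (D' (q i0 i2)).1 < (D' (q i0 i1)).1].

Definition elementary_move (R : realType) (D D' : diagram R) : Prop :=
  [\/ planar_isotopic D D', Omega1 D D', Omega2 D D' | Omega3 D D'].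

Definition knotoid_equiv (R : realType) : diagram R -> diagram R -> Prop :=
  clos_refl_sym_trans (diagram R) (@elementary_move R).

(** * Gauss diagrams *)

(* The points of the arc are the parameters in [0, 1]. A chord is the pair
   (starting point, end point). *)
Record gauss_diagram (R : realType) := GaussDiagram {
  chords : set (R * R);
  sgn : R * R -> int
}.

Definition gauss (R : realType) (D : diagram R) : gauss_diagram R :=
  {| chords := [set c | double_pairs D c /\ is_over D c.1];
     sgn := fun c => if 0 < det2 (derive1 D c.1) (derive1 D c.2) then 1 else -1 |}.

(* On a counterclockwise circle, the points on the right of the chord from s to u
   are those met when going counterclockwise from s to u. If s < u they form the
   interval ]s, u[; otherwise this path goes through the gap between the head and
   the tail. *)
Definition on_right (R : realType) (c : R * R) (x : R) : bool :=
  if c.1 < c.2 then c.1 < x < c.2 else (c.1 < x) || (x < c.2).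

Definition on_left (R : realType) (c : R * R) (x : R) : bool :=
  if c.1 < c.2 then (c.2 < x) || (x < c.1) else c.2 < x < c.1.

Section Index.
Variables (R : realType) (G : gauss_diagram R).
Implicit Types c e : R * R.

Definition rset c : set (R * R) :=
  [set e | [/\ chords G e, e != c, on_left c e.1 & on_right c e.2]].

Definition lset c : set (R * R) :=
  [set e | [/\ chords G e, e != c, on_right c e.1 & on_left c e.2]].

Definition with_sign (s : int) (A : set (R * R)) : set (R * R) :=
  [set e | A e /\ sgn G e = s].

Definition ncard (A : set (R * R)) : int := Posz #|` fset_set A|.

Definition deg c : int :=
  ncard (with_sign 1 (rset c)) - ncard (with_sign (-1) (rset c))
  - ncard (with_sign 1 (lset c)) + ncard (with_sign (-1) (lset c)).

Definition with_gcd (n : nat) c (A : set (R * R)) : set (R * R) :=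
  [set e | A e /\ gcdz (deg c) (deg e) = n].

(* (m %% 0)%Z = m *)
Definition phi c (m : int) : int := (m %% `|deg c|)%Z.

(* [malg K A]: finitely supported functions from K to A; [mkmalgU m a] is the
   function a at m and 0 elsewhere. As a Laurent polynomial in z, it is a z^m. *)
Definition laurent := malg int int.

Definition Ind (n : nat) c : laurent :=
  \sum_(e \in with_gcd n c (rset c)) mkmalgU (phi c (deg e)) (sgn G e)
  - \sum_(e \in with_gcd n c (lset c))
      mkmalgU (phi c (- deg e)) (sgn G e).

End Index.

(** * The symbols t^f and the function H *)

(* f = g in Z[z^{+1}, z^{-1}] / (z^k - 1), that is, f - g = z^k h - h for some
   Laurent polynomial h. *)
Definition eq_mod (k : nat) (f g : laurent) : Prop :=
  exists h : laurent, forall m : int,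
    mcoeff m f - mcoeff m g = mcoeff (m - k%:Z) h - mcoeff m h.

Lemma eq_mod_refl k f : eq_mod k f f.
Proof. by exists 0 => m; rewrite !mcoeff0 !subrr. Qed.

Lemma eq_mod_sym k f g : eq_mod k f g -> eq_mod k g f.
Proof.
move=> [h hP]; exists (- h) => m.
by rewrite !mcoeffN -opprB hP !opprB opprK addrC.
Qed.

Lemma eq_mod_trans k f g h : eq_mod k f g -> eq_mod k g h -> eq_mod k f h.
Proof.
move=> [u uP] [v vP]; exists (u + v) => m.
by rewrite !mcoeffD -(subrKA (mcoeff m g)) uP vP opprD addrACA.
Qed.

(* The pair (k, f) represents the class of f in R_k. Two such classes are
   identified when they are equal in the same R_k or are both zero. *)
Definition symb_rel (x y : nat * laurent) : bool :=
  `[< (x.1 = y.1 /\ eq_mod x.1 x.2 y.2) \/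
      (eq_mod x.1 x.2 0 /\ eq_mod y.1 y.2 0) >].

Lemma symb_refl : reflexive symb_rel.
Proof. by move=> x; apply/asboolP; left; split=> //; exact: eq_mod_refl. Qed.

Lemma symb_sym : symmetric symb_rel.
Proof.
have sym x y : symb_rel x y -> symb_rel y x.
  move=> /asboolP[[e xy]|[x0 y0]]; apply/asboolP; last by right.
  by left; split=> //; rewrite -e; exact: eq_mod_sym.
by move=> x y; apply/idP/idP; exact: sym.
Qed.

Lemma symb_trans : transitive symb_rel.
Proof.
move=> y x z /asboolP[[exy xy]|[x0 y0]] /asboolP[[eyz yz]|[y0' z0]];
  apply/asboolP.
- left; split; first by rewrite exy.
  by rewrite exy in xy *; exact: eq_mod_trans xy yz.
- by right; split=> //; rewrite exy in xy *; exact: eq_mod_trans xy y0'.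
- right; split=> //; rewrite -eyz.
  by apply: eq_mod_trans y0; exact: eq_mod_sym.
- by right.
Qed.

Canonical symb_equiv := EquivRel symb_rel symb_refl symb_sym symb_trans.

Definition symb : choiceType := {eq_quot symb_equiv}.

(* The symbol t^f, for the class f in R_k of a Laurent polynomial. *)
Definition tpow (k : nat) (f : laurent) : symb :=
  \pi_({eq_quot symb_equiv}) (k, f).

Definition tone : symb := tpow 0 0.

(* The free abelian group on the symbols, and the polynomials in y over it, in
   which [mkmalgU n x] is x y^n. *)
Definition tgroup := malg symb int.
Definition ypoly := malg nat tgroup.

(* sgn(c) (t^{Ind_c^n} - 1) y^n *)
Definition Hterm (R : realType) (G : gauss_diagram R) (c : R * R) (n : nat) :
    ypoly :=
  let x : tgroup :=
    mkmalgU (tpow `|deg G c|%N (Ind G n c)) 1 - mkmalgU tone 1 in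
  mkmalgU n (x *~ sgn G c).

Definition Hgauss (R : realType) (G : gauss_diagram R) : ypoly :=
  \sum_(x \in [set x : (R * R) * nat | chords G x.1]) Hterm G x.1 x.2.

Definition H (R : realType) (D : diagram R) : ypoly := Hgauss (gauss D).

(* Main.v *)
(* Both deg and Ind only depend on the signs of the chords and on the
   antisymmetric intersection numbers eps c e of pairs of chords. A planar isotopy
   preserves them because its Jacobian stays positive. A move in the box does not
   touch the chords of the crossings outside the box, nor their intersections with
   the others. The chord created by the first move intersects no chord. The two
   chords created by the second move are parallel with opposite signs, hence
   cancel. In the third move every two of the three chords x, y, z start or stop
   to intersect, while their signs and degrees do not change; suitably oriented,
   they satisfy d(x) + d(y) + d(z) = 0, so that d(y) = - d(z) mod d(x), and the
   contributions of y and z to Ind_x change by opposite amounts.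
   In the box the arcs are graphs of functions f_i, and the sign of a crossing of
   the arcs i and j is read off the sign of f_j - f_i next to it. *)

Require Import Defs.
From HB Require Import structures.
From mathcomp Require Import all_boot all_order all_algebra finmap perm.
From mathcomp Require Import all_classical all_reals all_analysis.
From mathcomp.multinomials Require monalg.
From mathcomp Require Import ring lra zify.

Set Implicit Arguments.
Unset Strict Implicit.
Unset Printing Implicit Defensive.

Import -(notations) monalg.
Import Order.TTheory GRing.Theory Num.Theory.
Import numFieldNormedType.Exports.

Local Open Scope classical_set_scope.
Local Open Scope ring_scope.

(** The statement about diagrams is turned into one about finite lists of chords with weights [sg]
    and [eps]; these lists can be renamed, shortened or cut at a common N. Exponents being reduced
    modulo |d(c)|, an equality in R_|d(c)| is obtained as an equality of representatives, and
    [symb_rel] only serves to identify t^0 with 1. In the third move the three arcs come in any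
    order of time, direction and height. Orienting the chords cyclically, from arc 0 to 1, 1 to 2
    and 2 to 0, moves the heights into the signs ox, oy, oz, and leaves the cyclic order of the
    arcs, their three directions and one sign s0, common to the gaps f_1 - f_0, f_2 - f_1, f_2 - f_0
    on the right side of the box. As the directions are kept while the left-right order is reversed,
    the two crossings on each arc exchange their order in time: hence each pair of chords starts or
    stops to intersect. A further obstacle is that the moves do not rule out by definition a
    crossing on a vertical side of the box, where no two-sided slope is available. It has to be
    excluded, using that the end points of the arcs are fixed. *)

(** * Weighted intersection data *)

(* Locked, as unification would unfold the finitely supported functions. *)
HB.lock Definition ind_term (n : nat) (dc de a g : int) : laurent :=
  if (a != 0) && (gcdz dc de == n)
  then mkmalgU ((a * de) %% `|dc|)%Z (a * g) else 0.

HB.lock Definition H_term (d : int) (f : laurent) (g : int) (n : nat) : ypoly :=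
  mkmalgU n ((mkmalgU (tpow `|d|%N f) 1 - mkmalgU tone 1 : tgroup) *~ g).

Section Weighted.
Variables (T : eqType) (sg : T -> int) (eps : T -> T -> int).

Definition wdeg (s : seq T) c : int := \sum_(e <- s) sg e * eps c e.

(** The integer [eps c e] is both a coefficient and a factor of the exponent: the value 1 gives the
    term of an e in r(c), the value -1 gives - sgn(e) z^(-d(e)) as for l(c). The two sums of the
    index function become one. *)
Definition wind (s : seq T) n c : laurent :=
  \sum_(e <- s) ind_term n (wdeg s c) (wdeg s e) (eps c e) (sg e).

(** The sum over n is cut at an arbitrary N, so that two diagrams whose degrees have different
    bounds can be compared at a common cut. *)
Definition wH (s : seq T) N : ypoly :=
  \sum_(c <- s) \sum_(n < N) H_term (wdeg s c) (wind s n c) (sg c) n.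

End Weighted.

Lemma ind_term0 n dc de g : ind_term n dc de 0 g = 0.
Proof. by rewrite ind_term.unlock eqxx. Qed.

(** A chord enters an index function through [a * g] and through its signed degree [a * de]. The gcd
    with [dc] and the residue modulo |dc| see the latter only modulo [dc], and the gcd ignores the
    sign [a]. *)
Lemma ind_term_congr n (dc de de' a a' g g' : int) :
  a ^+ 2 = 1 -> a' ^+ 2 = 1 -> a * g = a' * g' ->
  (exists k, a * de = a' * de' + k * dc) ->
  ind_term n dc de a g = ind_term n dc de' a' g'.
Proof.
move=> a1 a1' eg [k ek].
have sgcd (b : int) d : b ^+ 2 = 1 -> gcdz dc (b * d) = gcdz dc d.
  move=> /eqP; rewrite sqrf_eq1 => /orP[] /eqP->; first by rewrite mul1r.
  by rewrite mulN1r gcdzN.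
have nz (b : int) : b ^+ 2 = 1 -> b != 0.
  by apply: contra_eq_neq => ->.
rewrite ind_term.unlock !nz// -(sgcd a de)// -(sgcd a' de')// ek eg addrC.
rewrite gcdzMDl; case: ifP => // _; congr (mkmalgU _ _).
have [dc0|dc0] := leP 0 dc; first by rewrite ger0_norm// modzMDl.
by rewrite ltr0_norm// !modzN modzMDl.
Qed.

Lemma H_term0 d g n : d = 0 -> H_term d 0 g n = 0.
Proof. by move=> ->; rewrite H_term.unlock absz0 subrr mul0rz monalgU0. Qed.

Lemma eq_wH (T : eqType) s N (sg sg' : T -> int) (eps eps' : T -> T -> int) :
  {in s, sg =1 sg'} ->
  {in s, wdeg sg eps s =1 wdeg sg' eps' s} ->
  (forall n, {in s, wind sg eps s n =1 wind sg' eps' s n}) ->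
  wH sg eps s N = wH sg' eps' s N.
Proof.
move=> esg ed ei; apply: eq_big_seq => c cs; apply: eq_bigr => n _.
by rewrite (esg _ cs) (ed _ cs) (ei _ _ cs).
Qed.

Lemma ext_wH (T : eqType) s N (sg sg' : T -> int) (eps eps' : T -> T -> int) :
  {in s, sg =1 sg'} -> {in s &, eps =2 eps'} ->
  wH sg eps s N = wH sg' eps' s N.
Proof.
move=> esg eeps.
have ed : {in s, wdeg sg eps s =1 wdeg sg' eps' s}.
  by move=> c cs; apply: eq_big_seq => e es; rewrite esg// eeps.
apply: eq_wH => // n c cs; apply: eq_big_seq => e es.
by rewrite (ed _ cs) (ed _ es) (esg _ es) (eeps _ _ cs es).
Qed.

(** A chord is a pair of parameters, so an isotopy or a third move renames chords. The renaming is
    absorbed by pulling the weights back to the old list. *)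
Lemma wH_map (T T' : eqType) (f : T -> T') s N
    (sg : T' -> int) (eps : T' -> T' -> int) :
  wH sg eps (map f s) N = wH (sg \o f) (fun c e => eps (f c) (f e)) s N.
Proof.
have ed c : wdeg sg eps (map f s) (f c) =
    wdeg (sg \o f) (fun c e => eps (f c) (f e)) s c.
  by rewrite /wdeg big_map.
have ei n c : wind sg eps (map f s) n (f c) =
    wind (sg \o f) (fun c e => eps (f c) (f e)) s n c.
  by rewrite /wind big_map; apply: eq_bigr => e _; rewrite !ed.
by rewrite /wH big_map; apply: eq_bigr => c _; apply: eq_bigr => n _;
  rewrite ed ei.
Qed.

(** The chord adds nothing to the sums of the others. Its own degree and index functions have only
    zero terms, so its contribution is t^0 - 1 = 0. *)
Lemma wH_isolated (T : eqType) s N (sg : T -> int) eps x :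
  eps x x = 0 -> {in s, forall e, eps x e = 0 /\ eps e x = 0} ->
  wH sg eps (x :: s) N = wH sg eps s N.
Proof.
move=> exx ex.
have edx : wdeg sg eps (x :: s) x = 0.
  rewrite /wdeg big_cons exx mulr0 add0r big1_seq// => e /andP[_ es].
  by rewrite (ex e es).1 mulr0.
have ed : {in s, wdeg sg eps (x :: s) =1 wdeg sg eps s}.
  by move=> c cs; rewrite /wdeg big_cons (ex c cs).2 mulr0 add0r.
have eix n : wind sg eps (x :: s) n x = 0.
  rewrite /wind big_cons exx ind_term0 add0r big1_seq// => e /andP[_ es].
  by rewrite (ex e es).1 ind_term0.
have ei n : {in s, wind sg eps (x :: s) n =1 wind sg eps s n}.
  move=> c cs; rewrite /wind big_cons (ex c cs).2 ind_term0 add0r.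
  by apply: eq_big_seq => e es; rewrite !ed.
have Hx : \sum_(n < N)
    H_term (wdeg sg eps (x :: s) x) (wind sg eps (x :: s) n x) (sg x) n = 0.
  by apply: big1 => n _; rewrite eix; exact: H_term0.
rewrite /wH big_cons Hx add0r.
by apply: eq_big_seq => c cs; apply: eq_bigr => n _;
  rewrite (ed _ cs) (ei _ _ cs).
Qed.

Lemma ind_termN n dc de a g : ind_term n dc de a (- g) = - ind_term n dc de a g.
Proof.
by rewrite ind_term.unlock; case: ifP; rewrite ?oppr0// mulrN monalgUN.
Qed.

Lemma H_termN d f g n : H_term d f (- g) n = - H_term d f g n.
Proof. by rewrite H_term.unlock mulrNz monalgUN. Qed.

(* The two chords have the same degree d and, if they intersect, their
   contributions to the index functions of each other are z^d and z^(-d), which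
   agree in R_|d|. *)
Lemma wH_bigon (T : eqType) s N (sg : T -> int) eps p q :
  sg q = - sg p -> eps p p = 0 -> eps q q = 0 -> eps q p = - eps p q ->
  eps p q = 0 \/ eps p q ^+ 2 = 1 ->
  {in s, forall e, eps e p = eps e q /\ eps p e = eps q e} ->
  wH sg eps [:: p, q & s] N = wH sg eps s N.
Proof.
move=> esg epp eqq eqp epq ex.
have ed : {in s, wdeg sg eps [:: p, q & s] =1 wdeg sg eps s}.
  move=> c cs; rewrite /wdeg !big_cons (ex c cs).1 esg.
  by rewrite mulNr addrA subrr add0r.
have edp : wdeg sg eps [:: p, q & s] q = wdeg sg eps [:: p, q & s] p.
  rewrite /wdeg !big_cons esg epp eqq eqp !mulr0 mulrN mulNr !add0r.
  by congr (_ + _); apply: eq_big_seq => e es; rewrite (ex e es).2.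
have ei n : {in s, wind sg eps [:: p, q & s] n =1 wind sg eps s n}.
  move=> c cs; rewrite /wind !big_cons (ex c cs).1 esg edp ind_termN.
  by rewrite addrA subrr add0r; apply: eq_big_seq => e es; rewrite !ed.
have eip n : wind sg eps [:: p, q & s] n q = wind sg eps [:: p, q & s] n p.
  rewrite /wind !big_cons epp eqq edp !ind_term0 !add0r; congr (_ + _).
    case: epq => [e0|e1]; first by rewrite eqp e0 oppr0 !ind_term0.
    apply: ind_term_congr => //;
      rewrite eqp ?sqrrN ?esg ?mulrNN ?mulNr ?mulrN//.
    (* With d the common degree, - eps p q * d and eps p q * d differ by 2 eps p q * d. *)
    by exists (-2 * eps p q); ring.
  by apply: eq_big_seq => e es; rewrite (ex e es).2.
have Hq : \sum_(n < N) H_term (wdeg sg eps [:: p, q & s] q)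
      (wind sg eps [:: p, q & s] n q) (sg q) n =
    - \sum_(n < N) H_term (wdeg sg eps [:: p, q & s] p)
      (wind sg eps [:: p, q & s] n p) (sg p) n.
  by rewrite -sumrN; apply: eq_bigr => n _; rewrite edp eip esg H_termN.
rewrite /wH !big_cons Hq addrA subrr add0r.
by apply: eq_big_seq => c cs; apply: eq_bigr => n _;
  rewrite (ed _ cs) (ei _ _ cs).
Qed.

Definition bsign (b : bool) : int := if b then 1 else -1.

(** This compares what two chords y and z contribute to the degree of a third one, before and after
    both bits are negated. If u = w, the weights ky gy and kz gz are opposite and both sides are 0.
    If u <> w, the weights are equal and exactly one of the two chords counts on each side. *)
Lemma deg_toggle (ky kz gy gz : int) (u w : bool) :
  ky * gy * bsign w = - (kz * gz * bsign u) ->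
  gy * (ky * u%:R) + gz * (kz * w%:R) =
  gy * (ky * (~~ u)%:R) + gz * (kz * (~~ w)%:R).
Proof. by case: u w => [] [] /= ? ; lia. Qed.

(** The same dichotomy as in [deg_toggle], now for monomials: the last hypothesis makes the
    exponents ky dy and kz dz agree modulo d, so equal weights give equal terms and opposite weights
    cancel. *)
Lemma ind_toggle n (d dy dz ky kz gy gz : int) (u w : bool) :
  ky ^+ 2 = 1 -> kz ^+ 2 = 1 -> ky * gy * bsign w = - (kz * gz * bsign u) ->
  (exists k, ky * dy = kz * dz + k * d) ->
  ind_term n d dy (ky * u%:R) gy + ind_term n d dz (kz * w%:R) gz =
  ind_term n d dy (ky * (~~ u)%:R) gy + ind_term n d dz (kz * (~~ w)%:R) gz.
Proof.
move=> ky1 kz1 + edyz.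
case: u w => [] [] /=; rewrite ?mulr1n ?mulr0n ?mulr1 ?mulrN1 ?mulr0 ?ind_term0.
- move=> eg; rewrite addr0 (ind_term_congr n ky1 kz1 (g' := - gz) _ edyz).
    by rewrite ind_termN addNr.
  by rewrite mulrN.
- move=> /oppr_inj eg; rewrite addr0 add0r.
  exact: ind_term_congr ky1 kz1 eg edyz.
- rewrite opprK => eg; rewrite addr0 add0r.
  by rewrite (ind_term_congr n ky1 kz1 eg edyz).
- move=> eg; rewrite addr0 (ind_term_congr n ky1 kz1 (g' := - gz) _ edyz).
    by rewrite ind_termN addNr.
  by rewrite mulrN; apply: oppr_inj; rewrite eg.
Qed.

(* Up to the orientations ox, oy, oz, the chords x, y, z run around a triangle
   of arcs, and ka tells in which cyclic order these arcs are met. The bits u, v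
   and w tell which of the pairs (x, y), (y, z), (z, x) intersect; the move
   negates them. The signs being tied to these bits, the degrees do not change,
   and ox d(x) + oy d(y) + oz d(z) = 0. *)
Lemma wH_triangle (T : eqType) s N (sg : T -> int) (eps eps' : T -> T -> int)
    x y z (ox oy oz ka la : int) (u v w : bool) :
  ox ^+ 2 = 1 -> oy ^+ 2 = 1 -> oz ^+ 2 = 1 -> ka ^+ 2 = 1 ->
  ox * sg x = la * bsign v -> oy * sg y = la * bsign w ->
  oz * sg z = la * bsign u ->
  [/\ eps x x = 0, eps y y = 0, eps z z = 0, eps' x x = 0 & eps' y y = 0] ->
  eps' z z = 0 ->
  [/\ eps x y = ka * ox * oy * u%:R, eps y z = ka * oy * oz * v%:R,
      eps z x = ka * oz * ox * w%:R, eps y x = - eps x y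
      & eps z y = - eps y z] ->
  eps x z = - eps z x ->
  [/\ eps' x y = ka * ox * oy * (~~ u)%:R, eps' y z = ka * oy * oz * (~~ v)%:R,
      eps' z x = ka * oz * ox * (~~ w)%:R, eps' y x = - eps' x y
      & eps' z y = - eps' y z] ->
  eps' x z = - eps' z x ->
  {in s, forall e, ox * eps x e + oy * eps y e + oz * eps z e = 0} ->
  {in s, forall e, [/\ eps' x e = eps x e, eps' y e = eps y e
                     & eps' z e = eps z e]} ->
  {in s & [:: x, y, z & s], eps' =2 eps} ->
  wH sg eps' [:: x, y, z & s] N = wH sg eps [:: x, y, z & s] N.
Proof.
move=> ox2 oy2 oz2 ka2 gx gy gz [exx eyy ezz exx' eyy'] ezz'.
move=> [exy eyz ezx eyx ezy] exz [exy' eyz' ezx' eyx' ezy'] exz'.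
move=> cocycle ex ec.
have k1 (k o o' : int) : k ^+ 2 = 1 -> o ^+ 2 = 1 -> o' ^+ 2 = 1 ->
    (k * o * o') ^+ 2 = 1.
  by move=> k2 o2 o2'; rewrite !exprMn k2 o2 o2' !mul1r.
have k1N (k o o' : int) : k ^+ 2 = 1 -> o ^+ 2 = 1 -> o' ^+ 2 = 1 ->
    (- (k * o * o')) ^+ 2 = 1.
  by move=> k2 o2 o2'; rewrite sqrrN k1.
have bb b : bsign b ^+ 2 = 1 by case: b.
(* The sign relations that [deg_toggle] and [ind_toggle] require at x, y and z. Here, as oy sg y =
   la bsign w and oz sg z = la bsign u, both sides equal ka ox la. *)
have hx : (ka * ox * oy) * sg y * bsign w =
          - (- (ka * oz * ox) * sg z * bsign u).
  transitivity (ka * ox * (oy * sg y) * bsign w); first by ring.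
  transitivity (ka * ox * (oz * sg z) * bsign u); last by ring.
  transitivity (ka * ox * la * bsign w ^+ 2); first by rewrite gy; ring.
  by rewrite bb -(bb u) gz; ring.
have hy : (- (ka * ox * oy)) * sg x * bsign v =
          - (ka * oy * oz * sg z * bsign u).
  transitivity (- (ka * oy * (ox * sg x) * bsign v)); first by ring.
  transitivity (- (ka * oy * (oz * sg z) * bsign u)); last by ring.
  transitivity (- (ka * oy * la * bsign v ^+ 2)); first by rewrite gx; ring.
  by rewrite bb -(bb u) gz; ring.
have hz : (ka * oz * ox) * sg x * bsign v =
          - (- (ka * oy * oz) * sg y * bsign w).
  transitivity (ka * oz * (ox * sg x) * bsign v); first by ring.
  transitivity (ka * oz * (oy * sg y) * bsign w); last by ring.
  transitivity (ka * oz * la * bsign v ^+ 2); first by rewrite gx; ring.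
  by rewrite bb -(bb w) gy; ring.
pose t := [:: x, y, z & s].
pose d := wdeg sg eps t.
have ed : {in t, wdeg sg eps' t =1 d}.
  move=> c; rewrite /d /t /wdeg !inE => /or4P[/eqP->|/eqP->|/eqP->|cs].
  - rewrite !big_cons exx exx' !mulr0 !add0r !addrA; congr (_ + _).
      rewrite exz exz' exy exy' ezx ezx'.
      by rewrite -!(mulNr (ka * oz * ox)) -(deg_toggle hx).
    by apply: eq_big_seq => e /ex[->].
  - rewrite !big_cons eyy eyy' !mulr0 !add0r !addrA; congr (_ + _).
      rewrite eyx eyx' exy exy' eyz eyz'.
      by rewrite -!(mulNr (ka * ox * oy)) -(deg_toggle hy).
    by apply: eq_big_seq => e /ex[_ ->].
  - rewrite !big_cons ezz ezz' !mulr0 !add0r !addrA; congr (_ + _).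
      rewrite ezx ezx' ezy ezy' eyz eyz'.
      by rewrite -!(mulNr (ka * oy * oz)) -(deg_toggle hz).
    by apply: eq_big_seq => e /ex[_ _ ->].
  - by apply: eq_big_seq => e et; rewrite ec.
have dcocycle : ox * d x + oy * d y + oz * d z = 0.
  rewrite /d /t /wdeg !big_cons.
  set A := \sum_(e <- s) _; set B := \sum_(e <- s) _; set C := \sum_(e <- s) _.
  have ABC : ox * A + oy * B + oz * C = 0.
    rewrite !mulr_sumr -!big_split big1_seq//= => e es.
    transitivity (sg e * (ox * eps x e + oy * eps y e + oz * eps z e)).
      by ring.
    by rewrite cocycle// mulr0.
  rewrite exx eyy ezz eyx ezy exz exy eyz ezx.
  transitivity (ox * A + oy * B + oz * C + ka * (
    ox ^+ 2 * (oy * sg y * u%:R - oz * sg z * w%:R) +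
    oy ^+ 2 * (oz * sg z * v%:R - ox * sg x * u%:R) +
    oz ^+ 2 * (ox * sg x * w%:R - oy * sg y * v%:R))); first by ring.
  rewrite ABC ox2 oy2 oz2 gx gy gz add0r.
  by case: u v w {hx hy hz gx gy gz ed exy eyz ezx exy' eyz' ezx'}
    => [] [] [] /=; ring.
have ei n : {in t, wind sg eps' t n =1 wind sg eps t n}.
  move=> c ct.
  have -> : wind sg eps' t n c =
      \sum_(e <- t) ind_term n (d c) (d e) (eps' c e) (sg e).
    by apply: eq_big_seq => e et; rewrite !ed.
  rewrite /wind -/d.
  (* The witnesses come from multiplying [dcocycle] by ka ox, ka oy and ka oz respectively, the
     squares being 1. *)
  have kdx : exists k, ka * ox * oy * d y = - (ka * oz * ox) * d z + k * d x.
    exists (- ka); have -> : ka * ox * oy * d y = - ka * ox * (- (oy * d y)).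
      by ring.
    rewrite (_ : - (oy * d y) = ox * d x + oz * d z); last first.
      by apply/esym/eqP; rewrite -addr_eq0; apply/eqP; rewrite -dcocycle; ring.
    by transitivity (- ka * ox ^+ 2 * d x - ka * oz * ox * d z);
      [ring|rewrite ox2; ring].
  have kdy : exists k, - (ka * ox * oy) * d x = ka * oy * oz * d z + k * d y.
    exists ka; have -> : - (ka * ox * oy) * d x = ka * oy * (- (ox * d x)).
      by ring.
    rewrite (_ : - (ox * d x) = oy * d y + oz * d z); last first.
      by apply/esym/eqP; rewrite -addr_eq0; apply/eqP; rewrite -dcocycle; ring.
    by transitivity (ka * oy ^+ 2 * d y + ka * oy * oz * d z);
      [ring|rewrite oy2; ring].
  have kdz : exists k, ka * oz * ox * d x = - (ka * oy * oz) * d y + k * d z.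
    exists (- ka); have -> : ka * oz * ox * d x = - ka * oz * (- (ox * d x)).
      by ring.
    rewrite (_ : - (ox * d x) = oy * d y + oz * d z); last first.
      by apply/esym/eqP; rewrite -addr_eq0; apply/eqP; rewrite -dcocycle; ring.
    by transitivity (- ka * oz ^+ 2 * d z - ka * oy * oz * d y);
      [ring|rewrite oz2; ring].
  move: ct; rewrite !inE => /or4P[/eqP->|/eqP->|/eqP->|cs].
  - rewrite !big_cons exx exx' !ind_term0 !add0r !addrA; congr (_ + _).
      rewrite exz exz' exy exy' ezx ezx' -!(mulNr (ka * oz * ox)).
      by rewrite -(ind_toggle _ _ _ hx kdx)//; [exact: k1|exact: k1N].
    by apply: eq_big_seq => e /ex[->].
  - rewrite !big_cons eyy eyy' !ind_term0 !add0r !addrA; congr (_ + _).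
      rewrite eyx eyx' exy exy' eyz eyz' -!(mulNr (ka * ox * oy)).
      by rewrite -(ind_toggle _ _ _ hy kdy)//; [exact: k1N|exact: k1].
    by apply: eq_big_seq => e /ex[_ ->].
  - rewrite !big_cons ezz ezz' !ind_term0 !add0r !addrA; congr (_ + _).
      rewrite ezx ezx' ezy ezy' eyz eyz' -!(mulNr (ka * oy * oz)).
      by rewrite -(ind_toggle _ _ _ hz kdz)//; [exact: k1|exact: k1N].
    by apply: eq_big_seq => e /ex[_ _ ->].
  - by apply: eq_big_seq => e et; rewrite ec.
by apply: eq_wH.
Qed.

(** * From Gauss diagrams to weighted data *)

(* e is in r(c), in l(c) or in neither according as eps c e is 1, -1 or 0. As
   eps c c = 0, sums over the chords e != c may be taken over all chords. *)
Definition eps (R : realType) (c e : R * R) : int :=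
  (on_right c e.2)%:R - (on_right c e.1)%:R.

Section OnRight.
Variables (R : realType).
Implicit Types (c e : R * R) (x : R).

Lemma eps_self c : eps c c = 0.
Proof.
rewrite /eps /on_right !ltxx /= andbF orbF.
by case: ltP => //= ?; rewrite subrr.
Qed.

Lemma on_leftE c x : c.1 != c.2 -> x != c.1 -> x != c.2 ->
  on_left c x = ~~ on_right c x.
Proof.
rewrite /on_left /on_right; case: (ltgtP c.1 c.2) => //= c12 _ x1 x2.
  by rewrite negb_and -!leNgt !le_eqVlt (negbTE x1) eq_sym (negbTE x2) orbC.
by rewrite negb_or -!leNgt !le_eqVlt (negbTE x1) eq_sym (negbTE x2) andbC.
Qed.

Lemma on_right_rev c x : c.1 != c.2 -> x != c.1 -> x != c.2 ->
  on_right (c.2, c.1) x = ~~ on_right c x.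
Proof.
move=> c12 x1 x2; rewrite -on_leftE// /on_left /on_right/=.
by case: (ltgtP c.1 c.2) c12 => //=; rewrite orbC.
Qed.

End OnRight.

Section GaussData.
Variables (R : realType) (D : diagram R).

Lemma double_pairs_sym s t : double_pairs D (s, t) -> double_pairs D (t, s).
Proof. by case=> /= s01 t01 st e; split; rewrite //= eq_sym. Qed.

(** By [curve_double], a common end point forces e to be c or its reverse; the reverse is excluded
    because a chord starts at an over-passage. *)
Lemma chord_sep (c e : R * R) :
  chords (gauss D) c -> chords (gauss D) e -> c != e ->
  [/\ c.1 != c.2, e.1 != c.1, e.1 != c.2, e.2 != c.1 & e.2 != c.2].
Proof.
case: c e => [c1 c2] [e1 e2] /= [dc oc] [de oe] /= ce.
have [_ _ /= c12 _] := dc.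
have dc' := double_pairs_sym dc; have de' := double_pairs_sym de.
have over : ~ (e1 = c2 /\ e2 = c1).
  move=> [ee1 ee2]; have := over_under dc.
  by rewrite /= in oc oe; rewrite oc -ee1 oe.
split=> //; apply/eqP => E; subst.
- by have := curve_double dc de => E; rewrite E eqxx in ce.
- by apply: over; split=> //; exact: curve_double de dc'.
- by apply: over; split=> //; exact: curve_double de' dc.
- by have := curve_double dc' de' => E; rewrite E eqxx in ce.
Qed.

Lemma rsetE c e : chords (gauss D) c -> chords (gauss D) e ->
  rset (gauss D) c e <-> eps c e = 1.
Proof.
move=> cD eD; split=> [[_ ec]|].
  rewrite eq_sym in ec; have [c12 e11 e12 e21 e22] := chord_sep cD eD ec.
  by rewrite on_leftE// /eps => /negbTE-> ->.
have [<-|ec] := eqVneq c e; first by rewrite eps_self.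
have [c12 e11 e12 e21 e22] := chord_sep cD eD ec.
rewrite /eps => epos; split; rewrite // ?on_leftE// 1?eq_sym//.
  by move: epos; case: (on_right c e.1) => //; case: on_right.
by move: epos; case: (on_right c e.2) => //; case: on_right.
Qed.

Lemma lsetE c e : chords (gauss D) c -> chords (gauss D) e ->
  lset (gauss D) c e <-> eps c e = -1.
Proof.
move=> cD eD; split=> [[_ ec]|].
  rewrite eq_sym in ec; have [c12 e11 e12 e21 e22] := chord_sep cD eD ec.
  by rewrite on_leftE// /eps => -> /negbTE->.
have [<-|ec] := eqVneq c e; first by rewrite eps_self.
have [c12 e11 e12 e21 e22] := chord_sep cD eD ec.
rewrite /eps => epos; split; rewrite // ?on_leftE// 1?eq_sym//.
  by move: epos; case: (on_right c e.1) => //; case: on_right.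
by move: epos; case: (on_right c e.2) => //; case: on_right.
Qed.

Lemma epsP (c e : R * R) : [\/ eps c e = 0, eps c e = 1 | eps c e = -1].
Proof.
rewrite /eps; do 2 case: on_right; [exact: Or31|exact: Or32|exact: Or33|].
exact: Or31.
Qed.

Lemma sgnP c : sgn (gauss D) c = 1 \/ sgn (gauss D) c = -1.
Proof. by rewrite /=; case: ifP; [left|right]. Qed.

Variable s : seq (R * R).
Hypothesis us : uniq s.
Hypothesis sD : forall c, c \in s <-> chords (gauss D) c.

Lemma fsbig_chords (V : zmodType) (A : set (R * R)) (F : R * R -> V) :
  A `<=` chords (gauss D) ->
  \sum_(e \in A) F e = \sum_(e <- s) if e \in A then F e else 0.
Proof.
move=> AD; rewrite fsbig_mkcond -(fsbig_widen [set` s])//; last first.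
  move=> e [_ /= es]; rewrite /patch; case: ifP => // /set_mem/AD/sD.
  by move=> /es.
by rewrite -fsbig_seq.
Qed.

Lemma ncard_chords (A : set (R * R)) : A `<=` chords (gauss D) ->
  ncard A = \sum_(e <- s) (e \in A)%:R :> int.
Proof.
move=> AD; have fA : finite_set A.
  by apply: (@sub_finite_set _ _ [set` s]) => // e /AD/sD.
have -> : ncard A = \sum_(e \in A) (1 : int).
  rewrite fsbig_finite// /ncard card_fset_sum1 -natz natr_sum.
  by rewrite big_seq_fsetE.
by rewrite fsbig_chords//; apply: eq_bigr => e _; case: (e \in A).
Qed.

Lemma deg_wdeg c : chords (gauss D) c ->
  deg (gauss D) c = wdeg (sgn (gauss D)) (@eps R) s c.
Proof.
move=> cD.
rewrite /deg !ncard_chords; try by move=> e [[]].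
rewrite /wdeg -sumrB -sumrB -big_split/=; apply: eq_big_seq => e /sD eD.
have inE' g A : (e \in with_sign (gauss D) g A) =
    `[< A e >] && (sgn (gauss D) e == g).
  by apply/idP/andP => [/set_mem[/asboolP ? ->//]|[/asboolP ? /eqP ?]];
    rewrite inE; split.
rewrite !inE'.
have -> : `[< rset (gauss D) c e >] = (eps c e == 1).
  by apply/asboolP/eqP => /(rsetE cD eD).
have -> : `[< lset (gauss D) c e >] = (eps c e == -1).
  by apply/asboolP/eqP => /(lsetE cD eD).
by case: (epsP c e) => ->; have /= [->|->] := sgnP e.
Qed.

Lemma Ind_wind n c : chords (gauss D) c ->
  Ind (gauss D) n c = wind (sgn (gauss D)) (@eps R) s n c.
Proof.
move=> cD; rewrite /Ind !fsbig_chords; try by move=> e [[]].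
rewrite -sumrB; apply: eq_big_seq => e /sD eD.
have inE' A : (e \in with_gcd (gauss D) n c A) =
    `[< A e >] && (gcdz (deg (gauss D) c) (deg (gauss D) e) == n).
  by apply/idP/andP => [/set_mem[/asboolP ? ->//]|[/asboolP ? /eqP ?]];
    rewrite inE; split.
rewrite !inE' -!deg_wdeg//.
have -> : `[< rset (gauss D) c e >] = (eps c e == 1).
  by apply/asboolP/eqP => /(rsetE cD eD).
have -> : `[< lset (gauss D) c e >] = (eps c e == -1).
  by apply/asboolP/eqP => /(lsetE cD eD).
rewrite ind_term.unlock /phi.
case: (epsP c e) => -> /=; first by rewrite subr0.
  by rewrite !mul1r subr0.
by rewrite !mulN1r sub0r; case: ifP; rewrite ?oppr0// monalgUN.
Qed.

Lemma Hterm_H_term n c : chords (gauss D) c ->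
  Hterm (gauss D) c n = H_term (wdeg (sgn (gauss D)) (@eps R) s c)
    (wind (sgn (gauss D)) (@eps R) s n c) (sgn (gauss D) c) n.
Proof.
move=> cD; rewrite /Hterm H_term.unlock -(deg_wdeg cD) -(Ind_wind n cD).
reflexivity.
Qed.

(** Index functions vanish for n above every gcd of two degrees, so all cuts from M on give the same
    value. *)
Lemma H_wH : exists M, forall N, (M <= N)%N ->
  H D = wH (sgn (gauss D)) (@eps R) s N.
Proof.
pose d := wdeg (sgn (gauss D)) (@eps R) s.
pose M := (\max_(c <- s) \max_(e <- s) `|gcdz (d c) (d e)|%N).+1.
exists M => N MN; rewrite /H /Hgauss.
have Ind0 c n : c \in s -> (N <= n)%N ->
    wind (sgn (gauss D)) (@eps R) s n c = 0.
  move=> cs Nn; rewrite /wind big1_seq// => e /andP[_ es].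
  rewrite ind_term.unlock ifF//; apply/negbTE/nandP; right.
  apply: contraTneq (leq_trans MN Nn) => gn; rewrite -ltnNge ltnS.
  rewrite -[n]/(`|n%:Z|%N) -gn.
  by apply: leq_trans (leq_bigmax_seq _ cs _) => //; apply: leq_bigmax_seq.
have -> : [set x : (R * R) * nat | chords (gauss D) x.1] =
    chords (gauss D) `*` [set: nat].
  by apply/seteqP; split=> -[c n] //= [].
have fD : finite_set (chords (gauss D)).
  by apply: (@sub_finite_set _ _ [set` s]) => // e /sD.
rewrite -(fsbig_widen (chords (gauss D) `*` `I_N)).
- rewrite -pair_fsbig; [|exact: fD|exact: finite_II].
  rewrite fsbig_chords; last by move=> c.
  rewrite /wH; apply: eq_big_seq => c cs.
  rewrite ifT ?inE; last exact/sD.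
  rewrite -fsbig_ord; apply: eq_bigr => n _.
  by apply: Hterm_H_term; apply/sD.
- by move=> [c n] [].
- move=> [c n] [[/= cD _]] /not_andP[//|/negP]; rewrite -leqNgt => Nn.
  have cs : c \in s by apply/sD.
  rewrite /preimage /= (Hterm_H_term _ cD) (Ind0 _ _ cs Nn) H_term.unlock.
  (* Here the zeros of all R_k are identified, through the second clause of [symb_rel]. *)
  have -> : forall k, tpow k 0 = tone.
    move=> k; apply/eqmodP/asboolP; right; split; exact: eq_mod_refl.
  by rewrite subrr mul0rz monalgU0.
Qed.
End GaussData.

Lemma chords_enum (R : realType) (D : diagram R) : exists s : seq (R * R),
  uniq s /\ forall c, c \in s <-> chords (gauss D) c.
Proof.
have fD : finite_set (chords (gauss D)).
  by apply: sub_finite_set (curve_finite D) => c [].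
exists (fset_set (chords (gauss D))); split; first exact: fset_uniq.
by move=> c; rewrite in_fset_set// inE.
Qed.

Lemma H_eq (R : realType) (D D' : diagram R) (s s' : seq (R * R)) :
  uniq s -> (forall c, c \in s <-> chords (gauss D) c) ->
  uniq s' -> (forall c, c \in s' <-> chords (gauss D') c) ->
  (forall N, wH (sgn (gauss D)) (@eps R) s N =
             wH (sgn (gauss D')) (@eps R) s' N) ->
  H D = H D'.
Proof.
move=> us sD us' sD' e.
have [M HM] := H_wH us sD; have [M' HM'] := H_wH us' sD'.
by rewrite (HM (maxn M M') (leq_maxl _ _)) e -HM'// leq_maxr.
Qed.

(** * Planar isotopies *)

Section Smooth.
Variables (R : realType).

Lemma smooth_differentiable (V W : normedModType R) (f : V -> W) :
  smooth f -> forall x, differentiable f x.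
Proof. by move=> /(_ 1%N)[]. Qed.

Lemma smooth_continuous_derive (V W : normedModType R) (f : V -> W) v :
  smooth f -> continuous ('D_v f).
Proof. by move=> /(_ 1%N)[_ /(_ v)]. Qed.

Lemma smooth_continuous (V W : normedModType R) (f : V -> W) :
  smooth f -> continuous f.
Proof. by move=> /(_ 0%N). Qed.

Lemma det2_linear (L : {linear (R * R)%type -> (R * R)%type}) v w :
  det2 (L v) (L w) = det2 (L (1, 0)) (L (0, 1)) * det2 v w.
Proof.
have split_v (u : R * R) : L u = u.1 *: L (1, 0) + u.2 *: L (0, 1).
  rewrite -!linearZ -linearD; congr (L _).
  by case: u => a b; congr (_, _); rewrite /= /GRing.scale /=; ring.
rewrite (split_v v) (split_v w) /det2.
case: (L (1, 0)) (L (0, 1)) => [a b] [c d] /=.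
by rewrite /GRing.scale /=; ring.
Qed.

Lemma det2_cancel (L K : {linear (R * R)%type -> (R * R)%type}) :
  cancel L K -> det2 (L (1, 0)) (L (0, 1)) != 0.
Proof.
move=> LK; have := det2_linear K (L (1, 0)) (L (0, 1)).
rewrite !LK => /eqP; apply: contraTneq => ->.
by rewrite mulr0 /det2 /= mulr0 mulr1 subr0 oner_eq0.
Qed.

Variable h : R * (R * R) -> R * R.
Hypothesis sh : smooth h.

Lemma diff_slice tau p : is_diff p (fun q => h (tau, q))
  (fun v => 'd h (tau, p) (0, v)).
Proof.
have dp : is_diff p (fun q : R * R => (tau, q)) (fun v => ((0 : R), v)).
  by apply: is_diff_pair.
have dh : is_diff (tau, p) h ('d h (tau, p)).
  exact: DiffDef (smooth_differentiable sh _) _.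
exact: (is_diff_comp dp dh).
Qed.

(** The Jacobian of h(tau, .) at p. It is written with directional derivatives of [h] on the whole
    space so that smoothness of [h] gives continuity in tau. *)
Definition slice_jac p tau : R :=
  det2 ('D_(0, (1, 0)) h (tau, p)) ('D_(0, (0, 1)) h (tau, p)).

Lemma continuous_slice_jac p : continuous (slice_jac p).
Proof.
move=> tau.
have cd v : {for tau, continuous (fun t : R => 'D_(0, v) h (t, p))}.
  apply: (@continuous_comp _ _ _ (fun t => (t, p)) ('D_(0, v) h)).
    by apply: (cvg_pair (@cvg_id _ (nbhs tau)) (cvg_cst p)).
  exact: (@smooth_continuous_derive _ _ h (0, v) sh (tau, p)).
have c1 v : {for tau, continuous (fun t : R => ('D_(0, v) h (t, p)).1)}.
  by apply: continuous_comp; [exact: cd|exact: cvg_fst].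
have c2 v : {for tau, continuous (fun t : R => ('D_(0, v) h (t, p)).2)}.
  by apply: continuous_comp; [exact: cd|exact: cvg_snd].
by apply: cvgB; apply: cvgM; [exact: c1|exact: c2|exact: c2|exact: c1].
Qed.

Lemma slice_jacE p tau :
  slice_jac p tau = det2 ('d (fun q => h (tau, q)) p (1, 0))
                         ('d (fun q => h (tau, q)) p (0, 1)).
Proof.
have := diff_slice tau p => -[_ ->].
by rewrite /slice_jac !deriveE//; exact: smooth_differentiable.
Qed.

(** By the chain rule, the differential of k is a left inverse of that of the slice. *)
Lemma slice_jac_neq0 p tau k : smooth k -> cancel (fun q => h (tau, q)) k ->
  slice_jac p tau != 0.
Proof.
move=> sk hk; rewrite slice_jacE.
have dh := diff_slice tau p.
have dk : differentiable k (h (tau, p)) by exact: smooth_differentiable.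
have ds : differentiable (fun q => h (tau, q)) p by exact: ex_diff.
have e1 : 'd (k \o (fun q => h (tau, q))) p = id :> (R * R -> R * R).
  by rewrite (_ : _ \o _ = id); [exact: diff_val|apply/funext].
have e2 := diff_comp ds dk.
have e' v : 'd k (h (tau, p)) ('d (fun q => h (tau, q)) p v) = v.
  exact: (congr1 (fun f => f v) (etrans (esym e2) e1)).
exact: (det2_cancel e').
Qed.

(* The Jacobian is 1 at time 0 and never vanishes. *)
Lemma slice_jac_gt0 p : (forall q, h (0, q) = q) ->
  (forall tau, 0 <= tau <= 1 -> exists k : R * R -> R * R,
     smooth k /\ cancel (fun q => h (tau, q)) k) ->
  0 < slice_jac p 1.
Proof.
move=> h0 hk.
have J0 : slice_jac p 0 = 1.
  rewrite slice_jacE (_ : (fun q => h (0, q)) = id); last exact/funext.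
  by rewrite !diff_val /det2 /= mulr0 mulr1 subr0.
rewrite ltNge; apply/negP => J1.
have J01 : Num.min (slice_jac p 0) (slice_jac p 1) <= 0
    <= Num.max (slice_jac p 0) (slice_jac p 1).
  by rewrite J0 ge_min le_max J1 ler01 orbT.
have [tau] := IVT ler01 (continuous_subspaceT (@continuous_slice_jac p)) J01.
rewrite in_itv /= => /hk[k [sk kK]] /eqP.
by apply/negP; apply: slice_jac_neq0 sk kK.
Qed.

End Smooth.

Section Isotopy.
Variable R : realType.

Lemma derive1_diff (V : normedModType R) (f : R -> V) t :
  differentiable f t -> derive1 f t = 'd f t 1.
Proof. by move=> df; rewrite derive1E deriveE. Qed.

Lemma derive1_reparam (c : R -> R * R) (phi : R -> R) t :
  differentiable phi t -> differentiable c (phi t) ->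
  derive1 (c \o phi) t = derive1 phi t *: derive1 c (phi t).
Proof.
move=> dphi dc; have dcp := differentiable_comp dphi dc.
rewrite (derive1_diff dcp) (derive1_diff dc) (derive1_diff dphi).
transitivity ('d c (phi t) ('d phi t 1)).
  exact: (congr1 (fun f => f 1) (diff_comp dphi dc)).
by rewrite /= -linearZ /= /GRing.scale /= mulr1.
Qed.

Lemma derive1_postcomp (c : R -> R * R) (k : R * R -> R * R) t :
  differentiable c t -> differentiable k (c t) ->
  derive1 (k \o c) t = 'd k (c t) (derive1 c t).
Proof.
move=> dc dk; have dkc := differentiable_comp dc dk.
rewrite (derive1_diff dkc) (derive1_diff dc).
exact: (congr1 (fun f => f 1) (diff_comp dc dk)).
Qed.

Lemma near_eq_derive1 (V : normedModType R) (f g : R -> V) t :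
  (\near t, f t = g t) -> derive1 f t = derive1 g t.
Proof. by move=> fg; rewrite !derive1E; exact: near_eq_derive. Qed.

Lemma det2Z (a b : R) v w : det2 (a *: v) (b *: w) = a * b * det2 v w.
Proof. by rewrite /det2 /= /GRing.scale /=; ring. Qed.

Variables (D D' : diagram R) (h : R * (R * R) -> R * R) (phi : R -> R).
Hypothesis sh : smooth h.
Hypothesis h0 : forall p, h (0, p) = p.
Hypothesis hK : forall tau, 0 <= tau <= 1 -> exists k : R * R -> R * R,
  [/\ smooth k, cancel (fun p => h (tau, p)) k
    & cancel k (fun p => h (tau, p))].
Hypothesis sphi : smooth phi.
Hypothesis phi0 : phi 0 = 0.
Hypothesis phi1 : phi 1 = 1.
Hypothesis dphi : forall t, 0 <= t <= 1 -> 0 < derive1 phi t.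
Hypothesis D'phi : forall t, 0 <= t <= 1 -> D' (phi t) = h (1, D t).
Hypothesis over' :
  forall s t, double_pairs D (s, t) -> is_over D' (phi s) = is_over D s.

Lemma phi_lt s t : 0 <= s <= 1 -> 0 <= t <= 1 -> (phi s < phi t) = (s < t).
Proof.
suff incr x y : 0 <= x <= 1 -> 0 <= y <= 1 -> x < y -> phi x < phi y.
  move=> s01 t01; case: (ltgtP s t) => [st|ts|->]; last by rewrite ltxx.
    exact: incr.
  by apply/negbTE; rewrite -leNgt ltW// incr.
move=> x01 y01; apply: (@gtr0_derive1_lt_cc R phi 0 1);
  rewrite ?in_itv//=.
- by move=> z _; apply/derivable1_diffP; exact: smooth_differentiable.
- by move=> z; rewrite in_itv /= => /andP[z0 z1]; rewrite dphi// !ltW.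
- exact/continuous_subspaceT/smooth_continuous.
Qed.

Lemma phi_itv t : 0 <= t <= 1 -> 0 <= phi t <= 1.
Proof.
move=> t01; have /andP[t0 t1] := t01.
have I0 : 0 <= (0 : R) <= 1 by rewrite lexx ler01.
have I1 : 0 <= (1 : R) <= 1 by rewrite lexx ler01.
have := phi_lt t01 I0; have := phi_lt I1 t01.
rewrite phi0 phi1 (ltNge 1 t) t1 (ltNge t 0) t0 /= => /negbT + /negbT.
by rewrite -!leNgt => -> ->.
Qed.

Lemma phi_inj s t : 0 <= s <= 1 -> 0 <= t <= 1 -> phi s = phi t -> s = t.
Proof.
move=> s01 t01 e; case: (ltgtP s t) => // [st|ts].
  by move: st; rewrite -phi_lt// e ltxx.
by move: ts; rewrite -phi_lt// e ltxx.
Qed.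

Lemma phi_surj u : 0 <= u <= 1 -> exists2 t, 0 <= t <= 1 & phi t = u.
Proof.
move=> u01; have u01' : Num.min (phi 0) (phi 1) <= u <= Num.max (phi 0) (phi 1).
  by rewrite phi0 phi1 /Num.min /Num.max ltr01.
have [t] := IVT ler01 (continuous_subspaceT (smooth_continuous sphi)) u01'.
by rewrite in_itv; exists t.
Qed.

Lemma isotopy_double_pairs s t : 0 <= s <= 1 -> 0 <= t <= 1 ->
  double_pairs D' (phi s, phi t) <-> double_pairs D (s, t).
Proof.
move=> s01 t01; have [|k [_ kK _]] := hK (tau := 1).
  by rewrite ler01 lexx.
split=> -[/= ? ? st e]; split=> //=; try exact: phi_itv.
- by apply: contraNneq st => ->.
- by rewrite !D'phi// in e; exact: (can_inj kK e).
- by apply: contraNneq st => /phi_inj->.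
- by rewrite !D'phi//= e.
Qed.

(** The relation between the curves holds on [0, 1] alone, so it can be differentiated only at
    interior times. Crossings are interior by [curve_ends]. *)
Lemma isotopy_tangent t : 0 < t < 1 ->
  derive1 phi t *: derive1 D' (phi t) =
  'd (fun p => h (1, p)) (D t) (derive1 D t).
Proof.
move=> t01; rewrite -derive1_reparam; last 2 first.
- exact: smooth_differentiable.
- exact/smooth_differentiable/curve_smooth.
rewrite -derive1_postcomp; last 2 first.
- exact/smooth_differentiable/curve_smooth.
- by have [] := diff_slice sh 1 (D t).
apply: near_eq_derive1; near=> u => /=; apply: D'phi.
have : u \in `]0, 1[ by near: u; exact: near_in_itvoo.
by rewrite in_itv /= => /andP[? ?]; rewrite !ltW.
Unshelve. all: by end_near. Qed.

(** Up to positive factors due to phi, both tangents are transformed by the same differential, at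
    the common point D s = D t, and its determinant is positive. *)
Lemma isotopy_det2 s t : double_pairs D (s, t) ->
  (0 < det2 (derive1 D' (phi s)) (derive1 D' (phi t))) =
  (0 < det2 (derive1 D s) (derive1 D t)).
Proof.
move=> st; have s01 := curve_ends st.
have t01 := curve_ends (double_pairs_sym st).
have [/= s01' t01' _ e] := st.
have dd : 0 < derive1 phi s * derive1 phi t by rewrite mulr_gt0// dphi.
transitivity (0 < derive1 phi s * derive1 phi t *
    det2 (derive1 D' (phi s)) (derive1 D' (phi t))).
  exact: esym (pmulr_rgt0 _ dd).
rewrite -det2Z !isotopy_tangent// e det2_linear -slice_jacE// pmulr_rgt0//.
apply: slice_jac_gt0 => // tau /hK[k [sk kK _]].
by exists k.
Qed.

End Isotopy.

Lemma H_planar_isotopic (R : realType) (D D' : diagram R) :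
  planar_isotopic D D' -> H D = H D'.
Proof.
move=> [h [phi [sh h0 hK [sphi phi0 phi1 dphi] [D'phi over']]]].
have [s [us sD]] := chords_enum D.
pose f (c : R * R) := (phi c.1, phi c.2).
have f_lt := phi_lt sphi dphi.
have itv1 c : double_pairs D c -> 0 <= c.1 <= 1 by case.
have itv2 c : double_pairs D c -> 0 <= c.2 <= 1 by case.
have dpE := isotopy_double_pairs hK sphi phi0 phi1 dphi D'phi.
have finj : {in s &, injective f}.
  move=> c e /sD[/= cD _] /sD[/= eD _] [e1 e2].
  have := phi_inj sphi dphi (itv1 _ cD) (itv1 _ eD) e1.
  have := phi_inj sphi dphi (itv2 _ cD) (itv2 _ eD) e2.
  by case: c e {cD eD e1 e2} => [? ?] [? ?] /= -> ->.
apply: (H_eq us sD (s' := map f s)); first by rewrite map_inj_in_uniq.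
- move=> c; split.
    move=> /mapP[e /sD[/= eD oe] ->]; have [e1 e2] := (itv1 _ eD, itv2 _ eD).
    case: e eD oe e1 e2 => [u v] /= eD oe e1 e2.
    by split; [exact/dpE|rewrite /= (over' _ _ eD)].
  case: c => [u v] [/= cD' oc]; have [/= u01 v01 _ _] := cD'.
  have [x x01 xu] := phi_surj sphi phi0 phi1 u01.
  have [y y01 yv] := phi_surj sphi phi0 phi1 v01.
  rewrite -xu -yv in cD' oc *; move/dpE : cD' => /(_ x01 y01) cD.
  rewrite (over' _ _ cD) in oc.
  by apply: (map_f f (x := (x, y))); apply/sD.
have sgnE c : c \in s -> sgn (gauss D) c = sgn (gauss D') (f c).
  move=> /sD[]; case: c => u v cD _.
  exact: (congr1 (fun b : bool => if b then 1 else -1)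
    (esym (isotopy_det2 sh h0 hK sphi dphi D'phi cD))).
move=> N; apply: (etrans _ (esym (wH_map f s N (sgn (gauss D')) (@eps R)))).
apply: (@ext_wH _ s N); first exact: sgnE.
move=> c e /sD[/= cD _] /sD[/= eD _].
have [[c1 c2] [e1 e2]] := ((itv1 _ cD, itv2 _ cD), (itv1 _ eD, itv2 _ eD)).
by rewrite /eps /on_right /= !f_lt.
Qed.

(** * Replacing the arcs in the box *)

Section OnRightArcs.
Variable R : realType.
Implicit Types (c e : R * R) (x y z u v : R).

Lemma on_right_between e x y :
  (e.1 < x) = (e.1 < y) -> (x < e.2) = (y < e.2) ->
  on_right e x = on_right e y.
Proof. by rewrite /on_right => -> ->. Qed.

Lemma on_right_move u v u' v' z :
  (u < v) = (u' < v') -> (u < z) = (u' < z) -> (z < v) = (z < v') ->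
  on_right (u, v) z = on_right (u', v') z.
Proof. by rewrite /on_right /= => -> -> ->. Qed.

Lemma eps_anti c e : c.1 != c.2 -> e.1 != e.2 ->
  e.1 != c.1 -> e.1 != c.2 -> e.2 != c.1 -> e.2 != c.2 ->
  eps e c = - eps c e.
Proof.
case: c e => [c1 c2] [e1 e2] /=; rewrite /eps /on_right /=.
case: (ltgtP c1 c2) => // C; case: (ltgtP e1 e2) => // E;
case: (ltgtP e1 c1) => // E1; case: (ltgtP e1 c2) => // E2;
case: (ltgtP e2 c1) => // E3; case: (ltgtP e2 c2) => // E4 /=;
  solve [done|exfalso; lra].
Qed.

Definition orient (b : bool) c : R * R := if b then c else (c.2, c.1).

Lemma eps_orientr b c e : eps c (orient b e) = bsign b * eps c e.
Proof. by rewrite /eps; case: b => /=; rewrite ?mul1r// mulN1r opprB. Qed.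

Lemma eps_orientl b c e : c.1 != c.2 ->
  e.1 != c.1 -> e.1 != c.2 -> e.2 != c.1 -> e.2 != c.2 ->
  eps (orient b c) e = bsign b * eps c e.
Proof.
move=> c12 e11 e12 e21 e22; case: b; rewrite /= ?mul1r// mulN1r /eps.
by rewrite !on_right_rev//; do 2 case: on_right.
Qed.

(** The counterclockwise arcs from x to y, y to z and z to x close up, so they cover every other
    point of the circle equally often: once if x, y, z are in counterclockwise order, twice
    otherwise. *)
Lemma on_right_cycle x y z u v :
  x != y -> y != z -> z != x ->
  u \notin [:: x; y; z] -> v \notin [:: x; y; z] ->
  (on_right (x, y) u + on_right (y, z) u + on_right (z, x) u =
   on_right (x, y) v + on_right (y, z) v + on_right (z, x) v)%N.
Proof.
move=> xy yz zx.
have E w : w \notin [:: x; y; z] ->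
    (on_right (x, y) w + on_right (y, z) w + on_right (z, x) w)%N =
    ((x < y) + (y < z) + (z < x) == 1 :> nat).+1 :> nat.
  rewrite !inE !negb_or => /and3P[]; rewrite /on_right /=.
  case: (ltgtP x y) xy => // xy _; case: (ltgtP y z) yz => // yz _;
  case: (ltgtP z x) zx => // zx _;
  case: (ltgtP w x) => // wx; case: (ltgtP w y) => // wy;
  case: (ltgtP w z) => // wz /=; solve [done|exfalso; lra].
by move=> /E-> /E->.
Qed.

End OnRightArcs.

Section BoxReplacement.
Variables (R : realType) (k : nat) (a b : 'I_k -> R) (D D' : diagram R).
Hypothesis rep : box_replacement a b D D'.

Definition outer (t : R) := forall i, ~ (a i <= t <= b i).

Lemma arc_itv (C : diagram R) i t : box_arcs a b C -> a i <= t <= b i ->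
  0 <= t <= 1.
Proof.
move=> [/(_ i)[a0 _ b1] _ _] /andP[at_ tb].
by rewrite (le_trans (ltW a0) at_) (le_trans tb (ltW b1)).
Qed.

Lemma outer_curve t : 0 <= t <= 1 -> outer t -> D' t = D t.
Proof. by have [_ _ /(_ t)] := rep => H t01 /(H t01)[]. Qed.

Lemma outer_over t : 0 <= t <= 1 -> outer t -> is_over D' t = is_over D t.
Proof. by have [_ _ /(_ t)] := rep => H t01 /(H t01)[]. Qed.

Lemma near_outer t : outer t -> \forall u \near t, outer u.
Proof.
move=> ot.
apply: (@filter_forall R 'I_k (fun i u => ~ (a i <= u <= b i)) (nbhs t)) => i.
have /negP := ot i; rewrite negb_and -!ltNge => /orP[ta|bt].
  near=> u; have : u < a i by near: u; exact: lt_nbhsl.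
  by move=> ua /andP[]; rewrite leNgt ua.
near=> u; have : b i < u by near: u; exact: lt_nbhsr.
by move=> bu /andP[_]; rewrite leNgt bu.
Unshelve. all: by end_near. Qed.

Lemma outer_derive1 t : 0 < t < 1 -> outer t ->
  derive1 (curve D') t = derive1 (curve D) t.
Proof.
move=> t01 ot; apply: near_eq_derive1; near=> u; apply: outer_curve.
  have : u \in `]0, 1[ by near: u; exact: near_in_itvoo.
  by rewrite in_itv /= => /andP[? ?]; rewrite !ltW.
by near: u; exact: near_outer.
Unshelve. all: by end_near. Qed.

(** The replacement says nothing at the end points of the arcs. As the arcs are disjoint, times just
    before [a i] are outer, and continuity from the left gives the value at [a i]. *)
Lemma arc_start i : D' (a i) = D (a i).
Proof.
have [[ab dis _] _ _] := rep; have [a0 aib b1] := ab i.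
have cD (C : diagram R) : C x @[x --> (a i)^'-] --> C (a i).
  by apply: cvg_at_left_filter; apply: smooth_continuous; exact: curve_smooth.
apply: (@cvg_unique _ (@norm_hausdorff R (R * R)%type) _ _ _ _ (cD D')).
have nj : \forall u \near (a i)^'-, forall j, b j < a i -> b j < u.
  apply: (@filter_forall R 'I_k (fun j u => b j < a i -> b j < u)) => j.
  have [ji|_] := ltP (b j) (a i); last by near=> u.
  by near=> u => _; near: u; exact: nbhs_left_gt.
have := cD D; apply: cvg_trans; apply: near_eq_cvg; near=> u.
have ua : u < a i by near: u; exact: nbhs_left_lt.
apply/esym/outer_curve; first (apply/andP; split).
- by apply/ltW; near: u; exact: nbhs_left_gt.
- exact/ltW/(lt_trans ua)/(lt_trans aib).
move=> j /andP[aju ujb]; have [ji|ij] := eqVneq i j.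
  by subst j; move: aju; rewrite leNgt ua.
have [bi|bj] := dis _ _ ij.
  by have := le_lt_trans aju (lt_trans ua (lt_trans aib bi)); rewrite ltxx.
have : b j < u by move: j {aju ujb ij} bj; near: u.
by rewrite ltNge ujb.
Unshelve. all: by end_near. Qed.

Lemma arc_stop i : D' (b i) = D (b i).
Proof.
have [[ab dis _] _ _] := rep; have [a0 aib b1] := ab i.
have cD (C : diagram R) : C x @[x --> (b i)^'+] --> C (b i).
  by apply: cvg_at_right_filter; apply: smooth_continuous; exact: curve_smooth.
apply: (@cvg_unique _ (@norm_hausdorff R (R * R)%type) _ _ _ _ (cD D')).
have nj : \forall u \near (b i)^'+, forall j, b i < a j -> u < a j.
  apply: (@filter_forall R 'I_k (fun j u => b i < a j -> u < a j)) => j.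
  have [ij|_] := ltP (b i) (a j); last by near=> u.
  by near=> u => _; near: u; exact: nbhs_right_lt.
have := cD D; apply: cvg_trans; apply: near_eq_cvg; near=> u.
have bu : b i < u by near: u; exact: nbhs_right_gt.
apply/esym/outer_curve.
  apply/andP; split; first exact: ltW (lt_trans a0 (lt_trans aib bu)).
  by apply/ltW; near: u; exact: nbhs_right_lt.
move=> j /andP[aju ujb]; have [ji|ij] := eqVneq i j.
  by subst j; move: ujb; rewrite leNgt bu.
have [bi|bj] := dis _ _ ij; last first.
  by have := lt_le_trans (lt_trans (lt_trans bj aib) bu) ujb; rewrite ltxx.
have : u < a j by move: j {aju ujb ij} bi; near: u.
by rewrite ltNge aju.
Unshelve. all: by end_near. Qed.

(** By [box_arcs], being outer depends only on the point of the plane, which s and t share. Hence no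
    chord joins an outer time to an inner one. *)
Lemma pair_outer_iff (C : diagram R) s t :
  box_arcs a b C -> double_pairs C (s, t) -> outer s <-> outer t.
Proof.
move=> [_ _ bx] [/= s01 t01 _ e].
have H x : 0 <= x <= 1 -> outer x <-> ~ @box R (C x).
  move=> x01; split=> [ox /(bx _ x01)[i]|nb i xi]; first exact: ox.
  by apply: nb; apply/(bx _ x01); exists i.
by rewrite (H _ s01) (H _ t01) e.
Qed.

Lemma outer_double_pairs s t : outer s -> outer t ->
  double_pairs D' (s, t) <-> double_pairs D (s, t).
Proof.
by move=> os ot; split=> -[/= s01 t01 st e]; split=> //=; move: e;
  rewrite !outer_curve.
Qed.

Lemma outer_det2 s t : double_pairs D (s, t) -> outer s ->
  det2 (derive1 D' s) (derive1 D' t) = det2 (derive1 D s) (derive1 D t).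
Proof.
move=> st os; have [bD _ _] := rep.
have ot := (pair_outer_iff bD st).1 os.
have s01 := curve_ends st; have t01 := curve_ends (double_pairs_sym st).
exact: (f_equal2 (@det2 R) (outer_derive1 s01 os) (outer_derive1 t01 ot)).
Qed.

Lemma outer_chords c : outer c.1 ->
  chords (gauss D') c <-> chords (gauss D) c.
Proof.
case: c => s t /= os; have [bD bD' _] := rep.
have H (C : diagram R) : box_arcs a b C -> double_pairs C (s, t) -> outer t.
  by move=> bC st; apply/(pair_outer_iff bC st).
split=> -[/= st over_s]; have [/= s01 _ _ _] := st.
  have ot := H _ bD' st; split=> /=; last by rewrite -outer_over.
  exact/outer_double_pairs.
have ot := H _ bD st; split=> /=; last by rewrite outer_over.
exact/outer_double_pairs.
Qed.

Definition inner_enum (C : diagram R) (l : seq (R * R)) := uniq l /\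
  forall c, c \in l <-> chords (gauss C) c /\ ~ outer c.1.

(** Outer crossings keep their parameters, over/under information and tangents, so both diagrams can
    be enumerated with literally the same tail s. Each move then only changes the head of a list. *)
Lemma box_chords_split (l l' : seq (R * R)) :
  inner_enum D l -> inner_enum D' l' -> exists s,
  [/\ uniq (l ++ s) /\ (forall c, c \in l ++ s <-> chords (gauss D) c),
      uniq (l' ++ s) /\ (forall c, c \in l' ++ s <-> chords (gauss D') c),
      forall c, c \in s -> [/\ outer c.1, outer c.2, 0 <= c.1 <= 1,
        0 <= c.2 <= 1 & c.1 != c.2]
    & forall c, c \in s -> sgn (gauss D') c = sgn (gauss D) c].
Proof.
move=> [ul lE] [ul' lE']; have [s [us sD]] := chords_enum D.
pose s0 := [seq c <- s | `[< outer c.1 >]].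
have s0E c : c \in s0 <-> chords (gauss D) c /\ outer c.1.
  rewrite mem_filter; split=> [/andP[/asboolP ? /sD]//|[? ?]].
  by apply/andP; split; [exact/asboolP|exact/sD].
have join (C : diagram R) r : uniq r ->
    (forall c, c \in r <-> chords (gauss C) c /\ ~ outer c.1) ->
    (forall c, outer c.1 -> chords (gauss C) c <-> chords (gauss D) c) ->
    uniq (r ++ s0) /\ forall c, c \in r ++ s0 <-> chords (gauss C) c.
  move=> ur rE CD; split.
    rewrite cat_uniq ur filter_uniq// andbT; apply/hasPn => c /s0E[_ oc].
    by apply/negP => /rE[].
  move=> c; rewrite mem_cat; split.
    by move=> /orP[/rE[]//|/s0E[cD oc]]; exact/CD.
  move=> cC; have [oc|oc] := pselect (outer c.1); apply/orP.
    by right; exact: ((s0E c).2 (conj ((CD c oc).1 cC) oc)).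
  by left; exact: ((rE c).2 (conj cC oc)).
exists s0; split; first exact: (join D l).
- exact: (join D' l' ul' lE' outer_chords).
- move=> [u v] /s0E[[/= uv _] /= ou]; have [bD _ _] := rep.
  have [/= ? ? ? _] := uv; split=> //.
  exact/(pair_outer_iff bD uv).
- move=> [u v] /s0E[[/= uv _] /= ou].
  exact: (congr1 (fun x : R => if 0 < x then 1 else -1) (outer_det2 uv ou)).
Qed.

End BoxReplacement.

(** * The first move *)

Section InnerChords.
Variables (R : realType) (k : nat) (a b : 'I_k -> R).

(** An outer time is before the whole arc or after it. To an outer chord, an arc is therefore as
    good as a point. *)
Lemma outer_ltl i z x y : outer a b z -> a i <= x <= b i -> a i <= y <= b i ->
  (z < x) = (z < y).
Proof.
move=> /(_ i)/negP; rewrite negb_and -!ltNge => oz /andP[ax xb] /andP[ay yb].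
case: ltP => zx; case: ltP => zy //; case/orP: oz => oz; exfalso; lra.
Qed.

Lemma outer_ltr i z x y : outer a b z -> a i <= x <= b i -> a i <= y <= b i ->
  (x < z) = (y < z).
Proof.
move=> /(_ i)/negP; rewrite negb_and -!ltNge => oz /andP[ax xb] /andP[ay yb].
case: ltP => zx; case: ltP => zy //; case/orP: oz => oz; exfalso; lra.
Qed.

Lemma on_right_outer i e x y : outer a b e.1 -> outer a b e.2 ->
  a i <= x <= b i -> a i <= y <= b i -> on_right e x = on_right e y.
Proof.
move=> o1 o2 xi yi; apply: on_right_between.
  exact: outer_ltl xi yi.
exact: outer_ltr xi yi.
Qed.

Lemma eps_outer i j e p q : outer a b e.1 -> outer a b e.2 ->
  a i <= p.1 <= b i -> a i <= q.1 <= b i ->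
  a j <= p.2 <= b j -> a j <= q.2 <= b j -> eps e p = eps e q.
Proof.
move=> o1 o2 p1 q1 p2 q2; rewrite /eps.
by rewrite (on_right_outer o1 o2 p1 q1) (on_right_outer o1 o2 p2 q2).
Qed.

Lemma not_outer t : ~ outer a b t -> exists i, a i <= t <= b i.
Proof. by move=> /existsNP[i /contrapT]; exists i. Qed.

Lemma arc_not_outer i t : a i <= t <= b i -> ~ outer a b t.
Proof. by move=> ti /(_ i). Qed.

Lemma inner_crossing (C : diagram R) s t : box_arcs a b C ->
  double_pairs C (s, t) -> ~ outer a b s ->
  exists i j, arc_crossings a b C i j (s, t).
Proof.
move=> bC st os; have ot : ~ outer a b t by rewrite -(pair_outer_iff bC st).
have [i si] := not_outer os; have [j tj] := not_outer ot.
by exists i, j; split.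
Qed.

Definition crossing_chord (C : diagram R) c := orient (is_over C c.1) c.

Lemma crossing_chordP (C : diagram R) c d : double_pairs C c ->
  d = c \/ d = (c.2, c.1) -> is_over C d.1 -> d = crossing_chord C c.
Proof.
case: c => s t st; rewrite /crossing_chord /=.
have o := over_under st.
by move=> [->|->] /= od; [rewrite od|rewrite o od].
Qed.

Lemma chords_crossing_chord (C : diagram R) c : double_pairs C c ->
  chords (gauss C) (crossing_chord C c).
Proof.
case: c => s t st; have o := over_under st; rewrite /crossing_chord /=.
case: (boolP (is_over C s)) => os; first by split.
split; first exact: double_pairs_sym.
by move: os; rewrite /= o negbK.
Qed.

End InnerChords.

Lemma H_Omega1 (R : realType) (D D' : diagram R) : Omega1 D D' -> H D = H D'.
Proof.
move=> [a [b [rep none [s [u [su cross]]]]]]; have [bD bD' _] := rep.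
have [sc uc] : arc_crossings a b D' ord0 ord0 (s, u) /\
    arc_crossings a b D' ord0 ord0 (u, s) by rewrite cross; split; [left|right].
have [dsu si ui] := sc.
pose c := crossing_chord D' (s, u).
have eD : inner_enum a b D [::].
  split=> // -[v w]; split=> // -[[/= vw _] nv].
  have [i [j]] := inner_crossing bD vw nv.
  by rewrite !ord1 none.
have ci : a ord0 <= c.1 <= b ord0 /\ a ord0 <= c.2 <= b ord0.
  by rewrite /c /crossing_chord; case: is_over.
have eD' : inner_enum a b D' [:: c].
  split=> // -[v w]; rewrite inE; split.
    move=> /eqP->; split; first exact: chords_crossing_chord.
    by apply: arc_not_outer ci.1.
  move=> [[/= vw ov] nv]; have [i [j]] := inner_crossing bD' vw nv.
  rewrite !ord1 cross => e; apply/eqP.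
  by apply: crossing_chordP; [exact: dsu|case: e => ->; [left|right]|].
have [l [[ul lD] [ul' lD'] lo lsgn]] := box_chords_split rep eD eD'.
apply: (H_eq ul lD ul' lD') => N.
apply: etrans (esym (wH_isolated _ _ _ _)); last 2 first.
- exact: eps_self.
- move=> e /lo[ o1 o2 e1 e2 e12]; split; last first.
    by rewrite /eps (on_right_outer o1 o2 ci.1 ci.2) subrr.
  (* Both ends of c lie on the single arc, so all outer times are on one side of c: [on_right c] is
     constantly false on them if c.1 < c.2 and constantly true otherwise. *)
  rewrite /eps /on_right -(outer_ltl o1 ci.1 ci.2) -(outer_ltl o2 ci.1 ci.2).
  have neq z : outer a b z -> (z < c.1) = ~~ (c.1 < z).
    move=> oz; case: (ltgtP z c.1) => // zc.
    by case: (oz ord0); rewrite zc; exact: ci.1.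
  rewrite !(neq _ o1) !(neq _ o2).
  by case: (c.1 < c.2); case: (c.1 < e.1); case: (c.1 < e.2).
by apply: (@ext_wH _ l N) => [e el|//]; exact: esym (lsgn e el).
Qed.

(** * Arcs that are graphs *)

Section Coordinates.
Variables (R : realType) (c : R -> R * R).
Hypothesis sc : smooth c.

Lemma continuous_tangent : continuous (derive1 c).
Proof.
rewrite (_ : derive1 c = 'D_1 c); last by apply/funext => t; rewrite derive1E.
exact: smooth_continuous_derive.
Qed.

Lemma derive1_linear (L : {linear (R * R)%type -> R}) (t : R) : continuous L ->
  is_derive t 1 (L \o c) (L (derive1 c t)).
Proof.
move=> cL; have dc : differentiable c t by exact: smooth_differentiable.
have dL : differentiable L (c t) by exact: linear_differentiable.
have dLc := differentiable_comp dc dL.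
apply: DeriveDef; first exact/derivable1_diffP.
rewrite -derive1E (derive1_diff dLc) (derive1_diff dc).
apply: etrans (congr1 (fun f => f 1) (diff_comp dc dL)) _.
by rewrite /= (diff_lin _ cL).
Qed.

Lemma is_derive_fst (t : R) : is_derive t 1 (fun t => (c t).1) (derive1 c t).1.
Proof. by apply: (@derive1_linear fst) => p; exact: cvg_fst. Qed.

Lemma is_derive_snd (t : R) : is_derive t 1 (fun t => (c t).2) (derive1 c t).2.
Proof. by apply: (@derive1_linear snd) => p; exact: cvg_snd. Qed.

Lemma continuous_tangent_fst : continuous (fun t => (derive1 c t).1).
Proof.
move=> t; apply: (@continuous_comp _ _ _ (derive1 c) fst).
  exact: continuous_tangent.
exact: cvg_fst.
Qed.

End Coordinates.

Section GraphArc.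
Variables (R : realType) (x y dx dy : R -> R) (a b : R).
Hypothesis xdx : forall t : R, is_derive t 1 x (dx t).
Hypothesis ydy : forall t : R, is_derive t 1 y (dy t).
Hypothesis cdx : continuous dx.
Hypothesis ab : a < b.
Hypothesis xa : `|x a| = 1.
Hypothesis xb : `|x b| = 1.
Hypothesis dx0 : forall t, a <= t <= b -> dx t != 0.

Lemma graph_x_continuous : continuous x.
Proof.
by move=> t; apply/differentiable_continuous/derivable1_diffP; have [] := xdx t.
Qed.

Lemma graph_y_continuous : continuous y.
Proof.
by move=> t; apply/differentiable_continuous/derivable1_diffP; have [] := ydy t.
Qed.

Definition rightward : bool := 0 < dx a.

Lemma rightwardE t : a <= t <= b -> (0 < dx t) = rightward.
Proof.
move=> tab; have /andP[at_ tb] := tab; apply/eqP/negPn/negP => H.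
have sub u : u \in `[a, t] -> a <= u <= b.
  by rewrite in_itv /= => /andP[-> /le_trans->].
have z : Num.min (dx a) (dx t) <= 0
    <= Num.max (dx a) (dx t).
  rewrite ge_min le_max; move: H; rewrite /rightward.
  by case: (ltP 0 (dx a)) => H1; case: (ltP 0 (dx t)) => H2 // _;
    rewrite ?H1 ?H2 ?(ltW H1) ?(ltW H2) ?orbT.
have [u /sub uab /eqP] :=
  IVT at_ (continuous_subspaceT cdx) z.
by apply/negP/dx0.
Qed.

Lemma graph_lt s t : a <= s <= b -> a <= t <= b ->
  (x s < x t) = if rightward then s < t else t < s.
Proof.
have dX (u : R) : u \in `]a, b[ -> derivable x u 1.
  by move=> _; have [] := xdx u.
have dXE (u : R) : derive1 x u = dx u.
  by rewrite derive1E; have [] := xdx u.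
have cX := continuous_subspaceT graph_x_continuous.
have sub u : u \in `]a, b[ -> a <= u <= b.
  by rewrite in_itv /= => /andP[/ltW-> /ltW->].
case: (boolP rightward) => r sab tab.
  have mono u v : a <= u <= b -> a <= v <= b -> u < v -> x u < x v.
    move=> uab vab; apply: (gtr0_derive1_lt_cc dX) => //.
    by move=> w /sub wab; rewrite dXE rightwardE.
  case: (ltgtP s t) => [st|ts|->]; last by rewrite ltxx.
    exact: mono.
  by apply/negbTE; rewrite -leNgt ltW// mono.
have mono u v : a <= u <= b -> a <= v <= b -> u < v -> x v < x u.
  move=> uab vab; apply: (ltr0_derive1_lt_cc dX) => //.
  move=> w /sub wab; rewrite dXE lt_neqAle dx0//= leNgt rightwardE//.
case: (ltgtP s t) => [st|ts|->]; last by rewrite ltxx.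
  by apply/negbTE; rewrite -leNgt ltW// mono.
exact: mono.
Qed.

Lemma graph_inj s t : a <= s <= b -> a <= t <= b ->
  x s = x t -> s = t.
Proof.
move=> sab tab e; have := graph_lt sab tab; have := graph_lt tab sab.
by rewrite e ltxx; case: rightward; case: (ltgtP s t).
Qed.

(** The abscissa is strictly monotone, so its two end values, both of absolute value 1, are
    distinct. *)
Lemma graph_ends : x a = (if rightward then -1 else 1) /\
  x b = (if rightward then 1 else -1).
Proof.
have aab : a <= a <= b by rewrite lexx ltW.
have bab : a <= b <= b by rewrite lexx ltW.
have := graph_lt aab bab; have := graph_lt bab aab; move: xa xb.
have nba : (b < a) = false by apply/negbTE; rewrite -leNgt ltW.
have e1 : ((1 : R) < -1) = false by apply/negbTE; rewrite -leNgt; lra.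
have e2 : ((-1 : R) < 1) = true by lra.
rewrite ab nba.
have N (v : R) : `|v| = 1 -> v = 1 \/ v = -1.
  by move=> /eqP; rewrite eqr_norml => /andP[/orP[]/eqP]; [left|right].
by move=> /N[]-> /N[]->; case: rightward; rewrite ?ltxx ?e1 ?e2.
Qed.

Lemma graph_surj v : -1 <= v <= 1 -> exists2 t, a <= t <= b & x t = v.
Proof.
move=> v1; have [ea eb] := graph_ends.
have z : Num.min (x a) (x b) <= v <= Num.max (x a) (x b).
  rewrite ea eb ge_min le_max; case: rightward; have /andP[-> ->] := v1;
  by rewrite ?orbT.
have [t] := IVT (ltW ab) (continuous_subspaceT graph_x_continuous) z.
by rewrite in_itv; exists t.
Qed.

(** The inverse of x on [a, b]. The default value a is only taken outside [-1, 1], by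
    [graph_surj]. *)
Definition graph_param v : R := xget a [set t | a <= t <= b /\ x t = v].

Definition graph_fun v : R := y (graph_param v).

Lemma graph_paramK : {in `[a, b], cancel x graph_param}.
Proof.
move=> t; rewrite in_itv /= => tab; rewrite /graph_param.
case: xgetP => [u _ [uab]|/(_ t) []//]; exact: graph_inj.
Qed.

Lemma graph_funE t : a <= t <= b -> graph_fun (x t) = y t.
Proof. by move=> tab; rewrite /graph_fun graph_paramK ?in_itv. Qed.

Lemma graph_fun_continuous : {within `[-1, 1], continuous graph_fun}.
Proof.
have gc : {within `[-1, 1], continuous graph_param}.
  have [ea eb] := graph_ends.
  have := segment_can_continuous (ltW ab)
    (continuous_subspaceT graph_x_continuous) graph_paramK.
  have l1 : (-1 : R) <= 1 by lra.
  have l2 : ((1 : R) <= -1) = false by apply/negbTE; rewrite -ltNge; lra.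
  rewrite ea eb; case: rightward.
    by rewrite minEle maxEle l1.
  by rewrite minEle maxEle l2.
have -> : graph_fun = y \o graph_param by [].
move=> v.
exact: (@continuous_comp _ _ _ (from_subspace _ graph_param) y v (gc v)
  (@graph_y_continuous _)).
Qed.

(** The derivative of the inverse needs x to be inverted by [graph_param] on a neighbourhood of t,
    whence an interior t. *)
Lemma graph_fun_derive (t : R) : a < t < b ->
  is_derive (x t) 1 graph_fun (dy t / dx t).
Proof.
move=> tab; have tab' : a <= t <= b by have /andP[/ltW-> /ltW->] := tab.
have tab'' : t \in `]a, b[ by rewrite in_itv.
have dg : is_derive (x t) 1 graph_param (dx t)^-1.
  apply: (is_derive_inverse (f := fun t => x t)).
  - near=> u; apply: graph_paramK; apply: subset_itv_oo_cc.
    by near: u; exact: near_in_itvoo.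
  - by near=> u; exact: graph_x_continuous.
  - exact: dx0.
have dyt : is_derive (graph_param (x t)) 1 y (dy t).
  by rewrite graph_paramK ?in_itv//; exact: ydy.
have := is_derive1_comp dyt dg.
by rewrite mulrC.
Unshelve. all: by end_near. Qed.

End GraphArc.

(** * Signs of crossings of graphs *)

Section SimpleZero.
Variable R : realType.
Implicit Types (g : R -> R) (x y m : R).

(** By Caratheodory, g z = h z (z - x) with h continuous at x and h x = m, so g is positive just
    after x. A negative value at y would produce another zero. *)
Lemma pos_after_zero g x y m : x < y -> g x = 0 -> is_derive x 1 g m ->
  0 < m -> {within `[x, y], continuous g} ->
  (forall z, x < z <= y -> g z != 0) -> 0 < g y.
Proof.
move=> xy gx [dg eg] m0 cg nz; rewrite lt_neqAle eq_sym nz ?xy ?lexx//=.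
rewrite leNgt; apply/negP => gy.
have /is_derive1_caratheodory [h [hE ch hx]] : is_derive x 1 g m.
  by split.
have [z xzy hz] : exists2 z, x < z < y & 0 < h z.
  have : \forall z \near x^'+, 0 < h z.
    by apply: (cvgr_gt (h x)); [exact: cvg_at_right_filter|rewrite hx].
  move=> hpos; near x^'+ => z; exists z; last by near: z.
  by apply/andP; split; near: z; [exact: nbhs_right_gt|exact: nbhs_right_lt].
have /andP[xz zy] := xzy.
have gz : 0 < g z.
  have -> : g z = h z * (z - x) by rewrite -hE gx subr0.
  by rewrite mulr_gt0// subr_gt0.
have zyc : {within `[z, y], continuous g}.
  apply: continuous_subspaceW cg => u /=.
  by rewrite !in_itv /= => /andP[/(le_trans (ltW xz))-> ->].
have [|u] := IVT (v := 0) (ltW zy) zyc.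
  by rewrite ge_min le_max (ltW gy) (ltW gz) orbT.
rewrite in_itv /= => /andP[zu uy] /eqP; apply/negP/nz.
by rewrite uy (lt_le_trans xz).
Unshelve. all: by end_near. Qed.

Lemma sign_after_zero g x y m : x < y -> g x = 0 -> is_derive x 1 g m ->
  m != 0 -> {within `[x, y], continuous g} ->
  (forall z, x < z <= y -> g z != 0) -> (0 < g y) = (0 < m).
Proof.
move=> xy gx dg m0 cg nz; case: (ltrgt0P m) m0 => // m0 _.
  exact: (pos_after_zero xy gx dg m0 cg nz).
apply/negbTE; rewrite -leNgt -oppr_ge0 ltW//.
apply: (@pos_after_zero (fun z => - g z) x y (- m)) => //.
- by rewrite gx oppr0.
- by rewrite oppr_gt0.
- move=> u; exact: (@continuousN R R _ (from_subspace _ g) u (cg u)).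
- by move=> z /nz; rewrite oppr_eq0.
Qed.

(** Reflection z -> - z reduces this to [sign_after_zero]; it changes the sign of the slope, whence
    the negation. *)
Lemma sign_before_zero g x y m : y < x -> g x = 0 -> is_derive x 1 g m ->
  m != 0 -> {within `[y, x], continuous g} ->
  (forall z, y <= z < x -> g z != 0) -> (0 < g y) = ~~ (0 < m).
Proof.
move=> yx gx dg m0 cg nz.
have opp : {within `[- x, - y], continuous (g \o -%R)}.
  by apply: within_continuous_compN; rewrite !opprK.
have dN : is_derive (- x) 1 (-%R : R -> R) (-1) by exact: is_deriveNid.
have dgN : is_derive (- x) 1 (g \o -%R) (- m).
  have -> : - m = m * -1 by rewrite mulrN1.
  by apply: is_derive1_comp; rewrite opprK.
have := @sign_after_zero (g \o -%R) (- x) (- y) (- m) _ _ dgN _ opp _.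
rewrite /= !opprK oppr_eq0 ltrN2 => -> //.
  by rewrite oppr_gt0 -leNgt le_eqVlt (negbTE m0).
by move=> z /andP[xz zy]; apply: nz; lra.
Qed.

End SimpleZero.

Lemma mul_gt0_eq (R : realFieldType) (p q : R) : p != 0 -> q != 0 ->
  (0 < p * q) = ((0 < p) == (0 < q)).
Proof.
case: (ltrgt0P p) => // p0 _; case: (ltrgt0P q) => // q0 _.
- by rewrite pmulr_rgt0.
- by rewrite pmulr_rgt0// ltNge (ltW q0).
- by rewrite nmulr_rgt0// ltNge (ltW q0).
- by rewrite nmulr_rgt0.
Qed.

Lemma pmul3_gt0 (R : realFieldType) (p q r : R) : p != 0 -> q != 0 -> r != 0 ->
  (0 < p * q * r) = (((0 < p) == (0 < q)) == (0 < r)).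
Proof. by move=> p0 q0 r0; rewrite !mul_gt0_eq// mulf_neq0. Qed.

(** This separates the sign of a crossing into the horizontal directions of its strands and the
    slope of the gap between the two graphs. *)
Lemma det2_slopes (R : realType) (v w : R * R) : v.1 != 0 -> w.1 != 0 ->
  det2 v w = v.1 * w.1 * (w.2 / w.1 - v.2 / v.1).
Proof. by move=> v0 w0; rewrite /det2; field; rewrite v0. Qed.

Section Crossings.
Variables (R : realType) (k : nat) (a b : 'I_k -> R) (C : diagram R).
Hypothesis bC : box_arcs a b C.
Hypothesis gC : graph_arcs a b C.

Definition dir i : bool := rightward (fun t => (derive1 C t).1) (a i).

Definition arc_fun i : R -> R :=
  graph_fun (fun t => (C t).1) (fun t => (C t).2) (a i) (b i).

Let sC := curve_smooth C.

Lemma arc_lt i : a i < b i.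
Proof. by have [/(_ i)[]] := bC. Qed.

Lemma arc_dx0 i t : a i <= t <= b i -> (derive1 C t).1 != 0.
Proof. by move=> ti; have [_ _ /(_ t ti)[]] := gC i. Qed.

Lemma arc_dirE i t : a i <= t <= b i -> (0 < (derive1 C t).1) = dir i.
Proof. exact: rightwardE (continuous_tangent_fst sC) (@arc_dx0 i) _. Qed.

Lemma arc_x_lt i s t : a i <= s <= b i -> a i <= t <= b i ->
  ((C s).1 < (C t).1) = if dir i then s < t else t < s.
Proof.
exact: (graph_lt (is_derive_fst sC) (continuous_tangent_fst sC) (@arc_dx0 i)).
Qed.

Lemma arc_x_inj i s t : a i <= s <= b i -> a i <= t <= b i ->
  (C s).1 = (C t).1 -> s = t.
Proof.
exact: (graph_inj (is_derive_fst sC) (continuous_tangent_fst sC) (@arc_dx0 i)).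
Qed.

Lemma arc_x_ends i : (C (a i)).1 = (if dir i then -1 else 1) /\
  (C (b i)).1 = (if dir i then 1 else -1).
Proof.
have [xa xb _] := gC i.
exact: (graph_ends (is_derive_fst sC) (continuous_tangent_fst sC) (arc_lt i) xa
  xb (@arc_dx0 i)).
Qed.

Lemma arc_x_surj i v : -1 <= v <= 1 ->
  exists2 t, a i <= t <= b i & (C t).1 = v.
Proof.
have [xa xb _] := gC i.
exact: (graph_surj (is_derive_fst sC) (continuous_tangent_fst sC) (arc_lt i) xa
  xb (@arc_dx0 i)).
Qed.

Lemma arc_x_itv i t : a i <= t <= b i -> -1 <= (C t).1 <= 1.
Proof.
move=> ti; have [_ _ /(_ t (arc_itv bC ti))[_ H]] := bC.
have [|+ _] := H; first by exists i.
by rewrite ler_norml.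
Qed.

Lemma arc_x_interior i t : a i <= t <= b i -> `|(C t).1| != 1 -> a i < t < b i.
Proof.
have [xa xb _] := gC i; move=> /andP[at_ tb] t1.
rewrite !lt_neqAle at_ tb !andbT; apply/andP; split.
  by apply: contraNneq t1 => <-; rewrite xa.
by apply: contraNneq t1 => ->; rewrite xb.
Qed.

Lemma arc_funE i t : a i <= t <= b i -> arc_fun i (C t).1 = (C t).2.
Proof.
exact: (graph_funE (fun t => (C t).2) (is_derive_fst sC)
  (continuous_tangent_fst sC) (@arc_dx0 i)).
Qed.

Lemma arc_fun_continuous i : {within `[-1, 1], continuous (arc_fun i)}.
Proof.
have [xa xb _] := gC i.
exact: (graph_fun_continuous (is_derive_fst sC) (is_derive_snd sC)
  (continuous_tangent_fst sC) (arc_lt i) xa xb (@arc_dx0 i)).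
Qed.

Lemma arc_fun_derive i (t : R) : a i < t < b i ->
  is_derive (C t).1 1 (arc_fun i) ((derive1 C t).2 / (derive1 C t).1).
Proof.
exact: (graph_fun_derive (is_derive_fst sC) (is_derive_snd sC)
  (continuous_tangent_fst sC) (@arc_dx0 i)).
Qed.

(** For distinct arcs, the zeros of this function in [-1, 1] are the abscissae of their crossings,
    and transversality makes those strictly inside simple. *)
Definition arc_gap i j (v : R) : R := arc_fun j v - arc_fun i v.

Lemma arc_gap_continuous i j u v : -1 <= u -> v <= 1 ->
  {within `[u, v], continuous (arc_gap i j)}.
Proof.
move=> u1 v1.
have : {within `[-1, 1], continuous (arc_gap i j)}.
  move=> w; exact: (@continuousB _ _ _ (from_subspace _ (arc_fun j))
    (from_subspace _ (arc_fun i)) w (@arc_fun_continuous j w)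
    (@arc_fun_continuous i w)).
apply: continuous_subspaceW => w /=; rewrite !in_itv /= => /andP[uw wv].
by rewrite (le_trans u1 uw) (le_trans wv v1).
Qed.

Lemma arcs_disjoint i j s t : i != j -> a i <= s <= b i -> a j <= t <= b j ->
  (s < t) = (a i < a j) /\ s != t.
Proof.
move=> ij /andP[as_ sb] /andP[at_ tb]; have [_ /(_ i j ij) dis _] := bC.
have abi := arc_lt i; have abj := arc_lt j.
have [bi|bj] : s < t /\ a i < a j \/ t < s /\ a j < a i by lra.
- by rewrite bi.1 bi.2 lt_eqF// bi.1.
- by rewrite !ltNge (ltW bj.1) (ltW bj.2) gt_eqF// bj.1.
Qed.

Lemma arc_crossings_sym i j s t : arc_crossings a b C i j (s, t) ->
  arc_crossings a b C j i (t, s).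
Proof. by move=> [/double_pairs_sym]. Qed.

Lemma no_self_crossing i s t : ~ arc_crossings a b C i i (s, t).
Proof.
move=> [[/= _ _ /eqP st e] si ti]; apply: st.
by apply: (arc_x_inj si ti); rewrite e.
Qed.

Lemma arc_gap0 i j v : i != j -> -1 <= v <= 1 -> arc_gap i j v = 0 ->
  exists s t, arc_crossings a b C i j (s, t) /\ (C s).1 = v.
Proof.
move=> ij v1 /eqP; rewrite subr_eq0 => /eqP.
have [s si es] := arc_x_surj i v1; have [t tj et] := arc_x_surj j v1.
rewrite -{1}et -es !arc_funE// => e2; exists s, t; split=> //.
have [_ st] := arcs_disjoint ij si tj; split=> //; split=> //=.
- exact: arc_itv bC si.
- exact: arc_itv bC tj.
rewrite [LHS]surjective_pairing [RHS]surjective_pairing.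
by rewrite es et e2.
Qed.

Lemma crossing_gap i j s t : arc_crossings a b C i j (s, t) ->
  arc_gap i j (C s).1 = 0.
Proof.
move=> [[/= _ _ _ e] si tj].
by rewrite /arc_gap {1}e !arc_funE// e subrr.
Qed.

Definition slope_gap s t : R :=
  (derive1 C t).2 / (derive1 C t).1 - (derive1 C s).2 / (derive1 C s).1.

Lemma crossing_derive i j s t : arc_crossings a b C i j (s, t) ->
  `|(C s).1| != 1 -> is_derive (C s).1 1 (arc_gap i j) (slope_gap s t).
Proof.
move=> [[/= _ _ _ e] si tj] s1; have t1 : `|(C t).1| != 1 by rewrite -e.
have ds := arc_fun_derive (arc_x_interior si s1).
have := arc_fun_derive (arc_x_interior tj t1); rewrite -e => dt.
exact: (is_deriveB dt ds).
Qed.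

Lemma crossing_det2 i j s t : arc_crossings a b C i j (s, t) ->
  slope_gap s t != 0 /\ (0 < det2 (derive1 C s) (derive1 C t)) =
    ((dir i == dir j) == (0 < slope_gap s t)).
Proof.
move=> [st si tj]; have := curve_transverse st.
have [ds dt] := (arc_dx0 si, arc_dx0 tj).
have e := det2_slopes ds dt; rewrite -/(slope_gap s t) in e.
rewrite e => n0; have sg0 : slope_gap s t != 0.
  by apply: contraNneq n0 => ->; rewrite mulr0.
split=> //; apply: etrans (pmul3_gt0 ds dt sg0) _.
exact: (f_equal2 (fun x y => (x == y) == (0 < slope_gap s t))
  (arc_dirE si) (arc_dirE tj)).
Qed.

(** Up to v the gap has no further zero, so at v it still has the sign of its slope at the
    crossing. *)
Lemma crossing_sign_after i j s t v : i != j ->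
  arc_crossings a b C i j (s, t) -> `|(C s).1| != 1 -> (C s).1 < v <= 1 ->
  (forall s' t', arc_crossings a b C i j (s', t') ->
    ~ ((C s).1 < (C s').1 <= v)) ->
  (0 < det2 (derive1 C s) (derive1 C t)) =
  ((dir i == dir j) == (0 < arc_gap i j v)).
Proof.
move=> ij st s1 /andP[sv v1] nc; have [m0 ->] := crossing_det2 st.
have /andP[xs1 _] := arc_x_itv (let: And3 _ si _ := st in si).
congr (_ == _); apply: esym.
apply: (sign_after_zero sv (crossing_gap st) (crossing_derive st s1) m0).
  exact: arc_gap_continuous.
move=> z /andP[sz zv]; apply/eqP => gz.
have [|s' [t' [st' es']]] := arc_gap0 ij _ gz.
  by rewrite (le_trans xs1 (ltW sz)) (le_trans zv v1).
by apply: (nc _ _ st'); rewrite es' sz.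
Qed.

Lemma crossing_sign_before i j s t v : i != j ->
  arc_crossings a b C i j (s, t) -> `|(C s).1| != 1 -> -1 <= v < (C s).1 ->
  (forall s' t', arc_crossings a b C i j (s', t') ->
    ~ (v <= (C s').1 < (C s).1)) ->
  (0 < det2 (derive1 C s) (derive1 C t)) =
  ((dir i == dir j) == ~~ (0 < arc_gap i j v)).
Proof.
move=> ij st s1 /andP[v1 vs] nc; have [m0 ->] := crossing_det2 st.
have /andP[_ xs1] := arc_x_itv (let: And3 _ si _ := st in si).
congr (_ == _); apply: esym.
rewrite (sign_before_zero vs (crossing_gap st) (crossing_derive st s1) m0).
- by rewrite negbK.
- exact: arc_gap_continuous.
move=> z /andP[vz zs]; apply/eqP => gz.
have [|s' [t' [st' es']]] := arc_gap0 ij _ gz.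
  by rewrite (le_trans v1 vz) (le_trans (ltW zs) xs1).
by apply: (nc _ _ st'); rewrite es' vz.
Qed.

End Crossings.

Lemma box_replacement_sym (R : realType) k (a b : 'I_k -> R)
    (D D' : diagram R) :
  box_replacement a b D D' -> box_replacement a b D' D.
Proof. by move=> [bD bD' H]; split=> // t t01 /(H t t01)[-> ->]. Qed.

(** On a graph arc the abscissae 1 and -1 are attained only at the end points, which the replacement
    fixes. The lemma serves to exclude crossings on the sides of the box, where [arc_fun_derive]
    does not apply. *)
Lemma boundary_crossing (R : realType) k (a b : 'I_k -> R) (D D' : diagram R)
    i j s t : box_replacement a b D D' -> graph_arcs a b D' ->
  arc_crossings a b D' i j (s, t) -> `|(D' s).1| = 1 ->
  arc_crossings a b D i j (s, t) /\ D s = D' s.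
Proof.
move=> rep gD' [[/= s01 t01 st e] si tj] s1; have [_ bD' _] := rep.
have same l u : a l <= u <= b l -> `|(D' u).1| = 1 -> D u = D' u.
  move=> ul u1; have [xa xb] := arc_x_ends bD' gD' l.
  have aal : a l <= a l <= b l by rewrite lexx ltW// (arc_lt bD').
  have bbl : a l <= b l <= b l by rewrite lexx ltW// (arc_lt bD').
  have [e1|e1] : (D' u).1 = (D' (a l)).1 \/ (D' u).1 = (D' (b l)).1.
    rewrite xa xb; move/eqP: u1; rewrite eqr_norml => /andP[/orP[]/eqP-> _];
      by case: dir; ((by left) || (by right)).
  by rewrite (arc_x_inj gD' ul aal e1) (arc_start rep).
  by rewrite (arc_x_inj gD' ul bbl e1) (arc_stop rep).
have ts1 : `|(D' t).1| = 1 by rewrite -e.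
split; last exact: same si s1.
by split=> //; split=> //=; rewrite (same i)// (same j).
Qed.

(** * The second move *)

(** Exchanging the strands negates the determinant. Transversality matters: [sgn] would give -1 for
    a zero determinant in both orders. *)
Lemma sgn_orient (R : realType) (C : diagram R) d c : double_pairs C c ->
  sgn (gauss C) (orient d c) = bsign d * sgn (gauss C) c.
Proof.
case: d c => [|] [s t] st; first by rewrite mul1r.
have e : det2 (derive1 C t) (derive1 C s) = - det2 (derive1 C s) (derive1 C t).
  by rewrite /det2 opprB [X in X - _]mulrC [X in _ - X]mulrC.
have n0 := curve_transverse st.
have flip (r : R) : r != 0 ->
    (if 0 < - r then 1 else -1 : int) = - (if 0 < r then 1 else -1).
  by rewrite oppr_gt0; case: (ltrgt0P r) => //; rewrite opprK.
rewrite mulN1r; apply: etrans (flip _ n0).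
exact: (congr1 (fun r : R => if 0 < r then 1 else -1 : int) e).
Qed.

Lemma eps_arcs (R : realType) k (a b : 'I_k -> R) (C : diagram R) i j e p q :
  box_arcs a b C -> i != j -> outer a b e.1 -> outer a b e.2 ->
  a i <= p.1 <= b i -> a i <= q.1 <= b i ->
  a j <= p.2 <= b j -> a j <= q.2 <= b j -> eps p e = eps q e.
Proof.
move=> bC ij o1 o2 p1 q1 p2 q2; rewrite /eps.
have eq z : outer a b z -> on_right p z = on_right q z.
  move=> oz; case: p q p1 q1 p2 q2 => [p1' p2'] [q1' q2'] /= p1 q1 p2 q2.
  apply: on_right_move.
  - by rewrite (arcs_disjoint bC ij p1 p2).1 (arcs_disjoint bC ij q1 q2).1.
  - exact: outer_ltr oz p1 q1.
  - exact: outer_ltl oz p2 q2.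
by rewrite (eq _ o1) (eq _ o2).
Qed.

(** Between its two zeros the gap has a constant sign, which is that of its slope at the left zero
    and opposite to that of its slope at the right one. *)
Lemma bigon_signs (R : realType) k (a b : 'I_k -> R) (C : diagram R) i j p q :
  box_arcs a b C -> graph_arcs a b C -> i != j ->
  arc_crossings a b C i j = [set p; q] ->
  `|(C p.1).1| != 1 -> `|(C q.1).1| != 1 -> p != q ->
  sgn (gauss C) q = - sgn (gauss C) p.
Proof.
move=> bC gC ij cross.
have pq_cross : arc_crossings a b C i j p /\ arc_crossings a b C i j q.
  by rewrite cross; split; [left|right].
have [pC qC] := pq_cross.
wlog xpq : p q cross pC qC pq_cross / (C p.1).1 < (C q.1).1 => [W|] p1 q1 pq.
  have [xpq|xqp|xpq] := ltgtP (C p.1).1 (C q.1).1.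
  - exact: W xpq p1 q1 pq.
  - have := W q p; rewrite setUC => /(_ cross qC pC (conj qC pC) xqp q1 p1).
    by rewrite eq_sym => /(_ pq) ->; rewrite opprK.
  (* Equal abscissae would give equal parameters on both arcs, hence p = q. *)
  - case/eqP: pq; move: pC qC {W pq_cross p1 q1}; rewrite {cross}.
    case: p q xpq => [s t] [s' t'] /= xpq.
    move=> [[/= _ _ _ e] si tj] [[/= _ _ _ e'] si' tj'].
    rewrite (arc_x_inj gC si si' xpq); congr (_, _).
    by apply: (arc_x_inj gC tj tj'); rewrite -e -e'.
pose v := ((C p.1).1 + (C q.1).1) / 2.
have pv : (C p.1).1 < v by rewrite midf_lt.
have vq : v < (C q.1).1 by rewrite midf_lt.
have [_ pi _] := pC; have [_ qi _] := qC.
have /andP[xp _] := arc_x_itv bC pi; have /andP[_ xq] := arc_x_itv bC qi.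
have only s' t' : arc_crossings a b C i j (s', t') ->
    (C s').1 = (C p.1).1 \/ (C s').1 = (C q.1).1.
  by rewrite cross => -[<-|<-]; [left|right].
have dp : (0 < det2 (derive1 C p.1) (derive1 C p.2)) =
    ((dir a C i == dir a C j) == (0 < arc_gap a b C i j v)).
  apply: (crossing_sign_after bC gC ij); rewrite -?surjective_pairing//.
    by rewrite pv (le_trans (ltW vq) xq).
  move=> s' t' /only[->|->]; first by rewrite ltxx.
  by rewrite (leNgt _ v) vq andbF.
have dq : (0 < det2 (derive1 C q.1) (derive1 C q.2)) =
    ((dir a C i == dir a C j) == ~~ (0 < arc_gap a b C i j v)).
  apply: (crossing_sign_before bC gC ij); rewrite -?surjective_pairing//.
    by rewrite vq (le_trans xp (ltW pv)).
  move=> s' t' /only[->|->]; last by rewrite ltxx andbF.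
  by rewrite (leNgt v) pv.
have opp (d1 d2 : bool) : d2 = ~~ d1 -> bsign d2 = - bsign d1.
  by move=> ->; case: d1.
apply: opp; apply: etrans dq _; apply: etrans (congr1 negb (esym dp)).
by case: (dir a C i == dir a C j); case: (0 < arc_gap a b C i j v).
Qed.

Lemma H_Omega2 (R : realType) (D D' : diagram R) : Omega2 D D' -> H D = H D'.
Proof.
move=> [a [b [rep gD gD' none [p [q [pq cross over]]]]]].
have [bD bD' _] := rep.
pose i0 : 'I_2 := ord0; pose i1 : 'I_2 := ord_max.
have i01 : i0 != i1 by [].
have ord2 (i : 'I_2) : i = i0 \/ i = i1.
  by case: i => [[|[|//]] lt2]; [left|right]; exact: val_inj.
have [pC qC] : arc_crossings a b D' i0 i1 p /\ arc_crossings a b D' i0 i1 q.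
  by rewrite cross; split; [left|right].
(* A crossing on a side of the box would already be a crossing of D, which has none. *)
have interior r : arc_crossings a b D' i0 i1 r -> `|(D' r.1).1| != 1.
  case: r => s t st; apply/eqP => /(boundary_crossing rep gD' st)[].
  by rewrite none.
have sgn_pq := bigon_signs bD' gD' i01 cross (interior _ pC) (interior _ qC) pq.
(* By [over], this bit is the same at q, so the two chords start on the same arc and end on the same
   arc: they are parallel. *)
pose d := is_over D' p.1.
have eD : inner_enum a b D [::].
  split=> // -[v w]; split=> // -[[/= vw _] nv].
  have [i [j ij]] := inner_crossing bD vw nv.
  have [ei|ei] := ord2 i; have [ej|ej] := ord2 j; subst i j.
  - by have := no_self_crossing gD ij.
  - by move: ij; rewrite none.
  - by have := arc_crossings_sym ij; rewrite none.
  - by have := no_self_crossing gD ij.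
have [dp dq] : double_pairs D' p /\ double_pairs D' q.
  by case: pC qC => [? _ _] [? _ _].
have pd : orient d p = crossing_chord D' p by [].
have qd : orient d q = crossing_chord D' q by rewrite /crossing_chord -over.
have npq : orient d p != orient d q.
  apply: contra pq; case: (d); first by [].
  by case: p q {pC qC interior sgn_pq cross over dp dq pd qd d}
    => [? ?] [? ?] /eqP[-> ->].
have eD' : inner_enum a b D' [:: orient d p; orient d q].
  split; first by rewrite /= inE npq.
  move=> [v w]; split.
    rewrite !inE => /orP[]/eqP->.
      rewrite pd; split; first exact: chords_crossing_chord.
      rewrite -pd; case: (d); [case: pC => _ + _|case: pC => _ _];
        exact: arc_not_outer.
    rewrite qd; split; first exact: chords_crossing_chord.
    rewrite -qd; case: (d); [case: qC => _ + _|case: qC => _ _];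
      exact: arc_not_outer.
  move=> [[/= vw ov] nv]; have [i [j ij]] := inner_crossing bD' vw nv.
  rewrite !inE pd qd.
  have [ei|ei] := ord2 i; have [ej|ej] := ord2 j; subst i j.
  - by have := no_self_crossing gD' ij.
  - move: ij; rewrite cross => -[e|e]; apply/orP; [left|right]; apply/eqP;
      by apply: crossing_chordP => //; left.
  - have := arc_crossings_sym ij; rewrite cross => -[e|e]; apply/orP;
      [left|right]; apply/eqP; apply: crossing_chordP => //; right;
      by rewrite -e.
  - by have := no_self_crossing gD' ij.
have [l [[ul lD] [ul' lD'] lo lsgn]] := box_chords_split rep eD eD'.
have [i [j [ij [p1 q1] [p2 q2]]]] : exists i j, [/\ i != j,
    a i <= (orient d p).1 <= b i /\ a i <= (orient d q).1 <= b i
  & a j <= (orient d p).2 <= b j /\ a j <= (orient d q).2 <= b j].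
  case: pC qC => [_ p1 p2] [_ q1 q2].
  by case: (d); [exists i0, i1|exists i1, i0].
have [pD' qD'] : chords (gauss D') (orient d p) /\
    chords (gauss D') (orient d q).
  by rewrite pd qd; split; exact: chords_crossing_chord.
apply: (H_eq ul lD ul' lD') => N.
apply: etrans (esym (wH_bigon _ _ _ _ _ _ _)).
- by apply: (@ext_wH _ l N) => [e el|//]; exact: esym (lsgn e el).
- by rewrite (sgn_orient d dp) (sgn_orient d dq) sgn_pq mulrN.
- exact: eps_self.
- exact: eps_self.
- have [s1 s2 s3 s4 s5] := chord_sep pD' qD' npq.
  apply: eps_anti => //.
  by rewrite eq_sym in npq; have [] := chord_sep qD' pD' npq.
- by case: (epsP (orient d p) (orient d q)) => ->; [left|right|right].
- move=> e /lo[ o1 o2 _ _ _]; split; first exact: eps_outer o1 o2 p1 q1 p2 q2.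
  exact: eps_arcs bD' ij o1 o2 p1 q1 p2 q2.
Qed.

(** * Chords without common end points, and the chords of a triangle *)

Section Sep.
Variable R : realType.
Implicit Types c e : R * R.

Definition sep c e := [/\ c.1 != c.2, e.1 != e.2
  & [/\ e.1 != c.1, e.1 != c.2, e.2 != c.1 & e.2 != c.2]].

Lemma sep_anti c e : sep c e -> eps e c = - eps c e.
Proof. by move=> [? ? [*]]; exact: eps_anti. Qed.

Lemma sep_orient d d' c e : sep c e -> sep (orient d c) (orient d' e).
Proof.
move=> [h1 h2 [h3 h4 h5 h6]]; rewrite /sep.
by case: d; case: d' => /=; do ![split]; rewrite // eq_sym.
Qed.

Lemma sep_neq c e : sep c e -> c != e.
Proof. by move=> [_ _ [+ _ _ _]]; apply: contraNneq => ->. Qed.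

Lemma sep_eps d d' c e : sep c e ->
  eps (orient d c) (orient d' e) = bsign d * bsign d' * eps c e.
Proof. by move=> [? ? [*]]; rewrite eps_orientr eps_orientl//; ring. Qed.

Definition cmp_is (u v : R) (o : bool) := (u < v) = o /\ (v < u) = ~~ o.

(** Two consecutive chords of the cycle have ends on one common arc. Whether they intersect depends
    on the cyclic order of the arcs and on whether, along the common arc, the first chord ends
    before the second one starts. The bit d1 states this order, while d2 and d0 state the reverse
    one: hence one [==] and two [!=]. *)
Lemma triangle_eps (p01 p02 p10 p12 p20 p21 : R) (o01 o12 o02 d0 d1 d2 : bool) :
  {in [:: p01; p02] & [:: p10; p12], forall u v, cmp_is u v o01} ->
  {in [:: p10; p12] & [:: p20; p21], forall u v, cmp_is u v o12} ->
  {in [:: p01; p02] & [:: p20; p21], forall u v, cmp_is u v o02} ->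
  cmp_is p01 p02 d0 -> cmp_is p10 p12 d1 -> cmp_is p20 p21 d2 ->
  let cw := ~~ (if o01 then o12 || ~~ o02 else o12 && ~~ o02) in
  [/\ eps (p01, p10) (p12, p21) = bsign cw * (d1 == cw)%:R,
      eps (p12, p21) (p20, p02) = bsign cw * (d2 != cw)%:R
    & eps (p20, p02) (p01, p10) = bsign cw * (d0 != cw)%:R].
Proof.
move=> h01 h12 h02 [e0 e0r] [e1 e1r] [e2 e2r].
have m1 (u v : R) : u \in [:: u; v] by exact: mem_head.
have m2 (u v : R) : v \in [:: u; v] by rewrite !inE eqxx orbT.
have [a1 a1r] := h01 _ _ (m1 _ _) (m1 _ _).
have [a2 a2r] := h01 _ _ (m1 _ _) (m2 _ _).
have [a3 a3r] := h01 _ _ (m2 _ _) (m1 _ _).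
have [a4 a4r] := h01 _ _ (m2 _ _) (m2 _ _).
have [b1 b1r] := h12 _ _ (m1 _ _) (m1 _ _).
have [b2 b2r] := h12 _ _ (m1 _ _) (m2 _ _).
have [b3 b3r] := h12 _ _ (m2 _ _) (m1 _ _).
have [b4 b4r] := h12 _ _ (m2 _ _) (m2 _ _).
have [c1 c1r] := h02 _ _ (m1 _ _) (m1 _ _).
have [c2 c2r] := h02 _ _ (m1 _ _) (m2 _ _).
have [c3 c3r] := h02 _ _ (m2 _ _) (m1 _ _).
have [c4 c4r] := h02 _ _ (m2 _ _) (m2 _ _).
(* Transitivity rules out the two cyclic comparison patterns, for which the formulas would fail to
   describe three disjoint arcs; the rest is a finite check. *)
have t1 : o01 && o12 ==> o02.
  by rewrite -a1 -b1 -c1; apply/implyP => /andP[]; exact: lt_trans.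
have t2 : ~~ o12 && ~~ o01 ==> ~~ o02.
  by rewrite -a1r -b1r -c1r; apply/implyP => /andP[]; exact: lt_trans.
move: t1 t2; rewrite /eps /on_right /= ?(a1, a2, a3, a4, b1, b2, b3, b4).
rewrite ?(c1, c2, c3, c4, a1r, a2r, a3r, a4r, b1r, b2r, b3r, b4r).
rewrite ?(c1r, c2r, c3r, c4r, e0, e1, e2, e0r, e1r, e2r).
by case: o01 o12 o02 d0 d1 d2 {h01 h12 h02 a1 a2 a3 a4 b1 b2 b3 b4 c1 c2 c3 c4
  a1r a2r a3r a4r b1r b2r b3r b4r c1r c2r c3r c4r e0 e1 e2 e0r e1r e2r}
  => [] [] [] [] [] [].
Qed.

End Sep.

(** * Two graph arcs crossing exactly once *)

Section UniqueCrossing.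
Variables (R : realType) (k : nat) (a b : 'I_k -> R) (C : diagram R).
Hypothesis bC : box_arcs a b C.
Hypothesis gC : graph_arcs a b C.
Variables (i j : 'I_k) (s t : R).
Hypothesis ij : i != j.
Hypothesis st : arc_crossings a b C i j = [set (s, t)].
Hypothesis s1 : `|(C s).1| != 1.

Let stC : arc_crossings a b C i j (s, t). Proof. by rewrite st. Qed.

Lemma crossing_itv : -1 < (C s).1 < 1.
Proof.
have [_ si _] := stC; have /andP[h1 h2] := arc_x_itv bC si.
rewrite !lt_neqAle h1 h2 !andbT; apply/andP; split.
  by apply: contraNneq s1 => <-; rewrite normrN1.
by apply: contraNneq s1 => ->; rewrite normr1.
Qed.

Lemma unique_crossing_after v : (C s).1 < v <= 1 ->
  (0 < det2 (derive1 C s) (derive1 C t)) =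
  ((dir a C i == dir a C j) == (0 < arc_gap a b C i j v)).
Proof.
move=> sv; apply: (crossing_sign_after bC gC ij stC s1 sv) => s' t'.
by rewrite st => -[-> _]; rewrite ltxx.
Qed.

Lemma unique_crossing_before v : -1 <= v < (C s).1 ->
  (0 < det2 (derive1 C s) (derive1 C t)) =
  ((dir a C i == dir a C j) == ~~ (0 < arc_gap a b C i j v)).
Proof.
move=> vs; apply: (crossing_sign_before bC gC ij stC s1 vs) => s' t'.
by rewrite st => -[-> _]; rewrite ltxx andbF.
Qed.

Lemma unique_crossing_sign :
  (0 < det2 (derive1 C s) (derive1 C t)) =
  ((dir a C i == dir a C j) == (0 < arc_gap a b C i j 1)).
Proof.
by apply: unique_crossing_after; have /andP[_ ->] := crossing_itv; rewrite lexx.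
Qed.

(** The sign of the crossing can be read at v as well as at 1, with the same direction bits;
    comparing the two readings gives the claim. *)
Lemma gap_after v : (C s).1 < v <= 1 ->
  (0 < arc_gap a b C i j v) = (0 < arc_gap a b C i j 1).
Proof.
move=> /unique_crossing_after e1; have e2 := unique_crossing_sign.
move: (etrans (esym e1) e2).
by case: (dir a C i == dir a C j); case: (0 < arc_gap a b C i j v);
  case: (0 < arc_gap a b C i j 1).
Qed.

Lemma gap_before v : -1 <= v < (C s).1 ->
  (0 < arc_gap a b C i j v) = ~~ (0 < arc_gap a b C i j 1).
Proof.
move=> /unique_crossing_before e1; have e2 := unique_crossing_sign.
move: (etrans (esym e1) e2).
by case: (dir a C i == dir a C j); case: (0 < arc_gap a b C i j v);
  case: (0 < arc_gap a b C i j 1).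
Qed.

Lemma gap_neq0 v : -1 <= v <= 1 -> v != (C s).1 -> arc_gap a b C i j v != 0.
Proof.
move=> v1 vs; apply: contraNneq vs => /(arc_gap0 bC gC ij v1)[s' [t' []]].
by rewrite st => -[-> _] <-.
Qed.

End UniqueCrossing.

Section SameEnds.
Variables (R : realType) (k : nat) (a b : 'I_k -> R) (D D' : diagram R).
Hypothesis rep : box_replacement a b D D'.
Hypothesis gD : graph_arcs a b D.
Hypothesis gD' : graph_arcs a b D'.

(** The side on which an arc enters the box tells its direction, and [arc_start] fixes that
    point. *)
Lemma dir_replacement i : dir a D' i = dir a D i.
Proof.
have [bD bD' _] := rep; have [+ _] := arc_x_ends bD' gD' i.
have [+ _] := arc_x_ends bD gD i; rewrite (arc_start rep) => ->.
by case: (dir a D i); case: (dir a D' i) => // e; exfalso; lra.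
Qed.

Lemma arc_fun1 (C : diagram R) i : box_arcs a b C -> graph_arcs a b C ->
  arc_fun a b C i 1 = (C (if dir a C i then b i else a i)).2.
Proof.
move=> bC gC; have [e1 e2] := arc_x_ends bC gC i.
have abi := arc_lt bC i.
have itv : a i <= (if dir a C i then b i else a i) <= b i.
  by case: dir; rewrite lexx ?andbT ltW.
rewrite -(arc_funE gC itv); congr (arc_fun _ _ _ _ _).
by move: e1 e2; case: dir.
Qed.

(* The arcs keep their end points, so the sign of the crossing of two arcs that
   cross once is already determined on the right side of the box. *)
Lemma gap1_replacement i j : arc_gap a b D' i j 1 = arc_gap a b D i j 1.
Proof.
have [bD bD' _] := rep.
have e l : arc_fun a b D' l 1 = arc_fun a b D l 1.
  apply: etrans (arc_fun1 l bD' gD') (etrans _ (esym (arc_fun1 l bD gD))).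
  rewrite (dir_replacement l); case: (dir a D l).
    by rewrite (arc_stop rep).
  by rewrite (arc_start rep).
by rewrite /arc_gap !e.
Qed.

Lemma boundary_same i j s t s' t' :
  arc_crossings a b D i j (s, t) -> arc_crossings a b D' i j = [set (s', t')] ->
  `|(D s).1| = 1 -> (D' s').1 = (D s).1.
Proof.
move=> st e s1; have rep' := box_replacement_sym rep.
have [+ <-] := boundary_crossing rep' gD st s1.
by rewrite e => -[-> _].
Qed.

End SameEnds.

(** * The third move *)

Section TriangleChords.
Variables (R : realType) (a b : 'I_3 -> R) (C : diagram R).
Hypothesis bC : box_arcs a b C.
Hypothesis gC : graph_arcs a b C.
Variables (lev : {perm 'I_3}) (p : 'I_3 -> 'I_3 -> R).
Hypothesis tri : triangle a b lev p C.

Let i0 : 'I_3 := inord 0.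
Let i1 : 'I_3 := inord 1.
Let i2 : 'I_3 := inord 2.

Lemma ord3P (i : 'I_3) : [\/ i = i0, i = i1 | i = i2].
Proof.
by case: i => [[|[|[|//]]] lt3]; [apply: Or31|apply: Or32|apply: Or33];
  apply: val_inj; rewrite /= inordK.
Qed.

Lemma ord3_neq : [/\ i0 != i1, i1 != i2 & i0 != i2].
Proof. by split; rewrite -val_eqE /= !inordK. Qed.

Lemma tri_cross i j : i != j -> arc_crossings a b C i j (p i j, p j i).
Proof. by move=> /tri[-> _]. Qed.

Lemma tri_itv i j : i != j -> a i <= p i j <= b i.
Proof. by move=> /tri_cross[]. Qed.

Lemma tri_double i j : i != j -> double_pairs C (p i j, p j i).
Proof. by move=> /tri_cross[]. Qed.

Lemma tri_x i j : i != j -> (C (p j i)).1 = (C (p i j)).1.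
Proof. by move=> /tri_double[_ _ _ /= ->]. Qed.

Lemma cmp_arcs i j s t : i != j -> a i <= s <= b i -> a j <= t <= b j ->
  cmp_is s t (a i < a j).
Proof.
move=> ij si tj; have [e st] := arcs_disjoint bC ij si tj; split=> //.
by rewrite -e; case: (ltgtP s t) st.
Qed.

Lemma cmp_arc i s t : a i <= s <= b i -> a i <= t <= b i ->
  (C s).1 < (C t).1 -> cmp_is s t (dir a C i).
Proof.
move=> si ti; rewrite (arc_x_lt gC si ti); rewrite /cmp_is.
by case: dir => st; rewrite st ?(lt_gtF st).
Qed.

Lemma cmp_arc_sym (s t : R) d : cmp_is s t d -> cmp_is t s (~~ d).
Proof. by move=> [e e']; split; rewrite ?negbK. Qed.

Definition tri_chord i j : R * R := orient (lev j < lev i)%N (p i j, p j i).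

Lemma tri_chordE i j : i != j ->
  tri_chord i j = crossing_chord C (p i j, p j i).
Proof. by move=> /tri[_ /= e]; rewrite /crossing_chord e. Qed.

Lemma tri_chord_sym i j : i != j -> tri_chord j i = tri_chord i j.
Proof.
move=> ij; rewrite /tri_chord.
have : lev i != lev j by rewrite (inj_eq perm_inj).
by rewrite -val_eqE /=; case: ltngtP.
Qed.

Lemma tri_chord_arcs i j : i != j ->
  ~ outer a b (tri_chord i j).1 /\ ~ outer a b (tri_chord i j).2.
Proof.
move=> ij; have ji : j != i by rewrite eq_sym.
have h1 := arc_not_outer (tri_itv ij); have h2 := arc_not_outer (tri_itv ji).
by rewrite /tri_chord; case: (_ < _)%N.
Qed.

Hypothesis x01_02 : (C (p i0 i1)).1 != (C (p i0 i2)).1.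
Hypothesis x02_12 : (C (p i0 i2)).1 != (C (p i1 i2)).1.
Hypothesis x01_12 : (C (p i0 i1)).1 != (C (p i1 i2)).1.

(** Ends on different arcs differ because the arcs are disjoint; ends on the same arc differ because
    the crossings have different abscissae. *)
Lemma tri_sep : [/\ sep (p i0 i1, p i1 i0) (p i1 i2, p i2 i1),
  sep (p i1 i2, p i2 i1) (p i2 i0, p i0 i2)
  & sep (p i2 i0, p i0 i2) (p i0 i1, p i1 i0)].
Proof.
have [n01 n12 n02] := ord3_neq.
have n10 : i1 != i0 by rewrite eq_sym.
have n21 : i2 != i1 by rewrite eq_sym.
have n20 : i2 != i0 by rewrite eq_sym.
have [[t01 t12] t02] := (tri_itv n01, tri_itv n12, tri_itv n02).
have [[t10 t21] t20] := (tri_itv n10, tri_itv n21, tri_itv n20).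
have dis i j s t (ij : i != j) (si : a i <= s <= b i) (tj : a j <= t <= b j) :=
  (arcs_disjoint bC ij si tj).2.
have s0 : p i0 i1 != p i0 i2 by apply: contraNneq x01_02 => ->.
have s1 : p i1 i2 != p i1 i0.
  by apply: contraNneq x01_12 => e; rewrite -(tri_x n01) e.
have s2 : p i2 i0 != p i2 i1.
  by apply: contraNneq x02_12 => e; rewrite -(tri_x n02) -(tri_x n12) e.
have [XX [YY ZZ]] := (dis _ _ _ _ n01 t01 t10,
  (dis _ _ _ _ n12 t12 t21, dis _ _ _ _ n20 t20 t02)).
split; split=> //=; split=> //.
- exact: dis n10 t12 t01.
- exact: dis n20 t21 t01.
- exact: dis n21 t21 t10.
- exact: dis n21 t20 t12.
- exact: dis n01 t02 t12.
- exact: dis n02 t02 t21.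
- exact: dis n02 t01 t20.
- exact: dis n12 t10 t20.
- exact: dis n10 t10 t02.
Qed.

Lemma tri_inner_enum : inner_enum a b C
  [:: tri_chord i0 i1; tri_chord i1 i2; tri_chord i2 i0].
Proof.
have [n01 n12 n02] := ord3_neq.
have n20 : i2 != i0 by rewrite eq_sym.
have [sXY sYZ sZX] := tri_sep.
split.
  rewrite /= !inE negb_or !andbT (sep_neq (sep_orient _ _ sXY)).
  rewrite (sep_neq (sep_orient _ _ sYZ)) andbT eq_sym.
  exact: sep_neq (sep_orient _ _ sZX).
move=> [v w]; split.
  rewrite !inE => /or3P[]/eqP->;
    (split; last by apply: (proj1 (tri_chord_arcs _)));
    by rewrite tri_chordE//; apply: chords_crossing_chord; exact: tri_double.
move=> [[/= vw ov] nv]; have [i [j ijC]] := inner_crossing bC vw nv.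
have ij : i != j.
  by apply/eqP => e; move: ijC; rewrite -e; apply: (no_self_crossing gC).
have -> : (v, w) = tri_chord i j.
  rewrite (tri_chordE ij).
  apply: crossing_chordP => //; first exact: tri_double.
  by left; have [e _] := tri ij; move: ijC; rewrite e.
rewrite !inE.
case: (ord3P i) ij => ->; case: (ord3P j) => ->; rewrite ?eqxx ?orbT// => ij.
- by rewrite (tri_chord_sym n20) eqxx !orbT.
- by rewrite (tri_chord_sym n01) eqxx.
- by rewrite (tri_chord_sym n12) eqxx !orbT.
Qed.

Lemma tri_sgn i j : i != j -> `|(C (p i j)).1| != 1 ->
  sgn (gauss C) (p i j, p j i) =
  bsign ((dir a C i == dir a C j) == (0 < arc_gap a b C i j 1)).
Proof.
move=> ij x1; have [e _] := tri ij.
exact: (congr1 bsign (unique_crossing_sign bC gC ij e x1)).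
Qed.

Lemma tri_chord_sgn i j : i != j ->
  bsign (lev j < lev i)%N * sgn (gauss C) (tri_chord i j) =
  sgn (gauss C) (p i j, p j i).
Proof.
move=> ij; have e := sgn_orient (lev j < lev i)%N (tri_double ij).
apply: etrans (congr1 (fun x => bsign (lev j < lev i)%N * x) e) _.
by case: (_ < _)%N; rewrite /bsign ?mul1r// mulN1r mulN1r opprK.
Qed.

(** The gaps satisfy g01 + g12 = g02. At the middle crossing g02 = 0, so g12 = - g01 there; this
    point is after the zero of g01 and before that of g12, which changes sign once more. At the last
    crossing g12 = 0, so g02 = g01, both past their zeros. *)
Lemma tri_gap_const : `|(C (p i0 i1)).1| != 1 -> `|(C (p i1 i2)).1| != 1 ->
  `|(C (p i0 i2)).1| != 1 ->
  (C (p i0 i1)).1 < (C (p i0 i2)).1 < (C (p i1 i2)).1 ->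
  (0 < arc_gap a b C i1 i2 1) = (0 < arc_gap a b C i0 i1 1) /\
  (0 < arc_gap a b C i0 i2 1) = (0 < arc_gap a b C i0 i1 1).
Proof.
move=> y01 y12 y02 /andP[lt1 lt2]; have [n01 n12 n02] := ord3_neq.
have [[e01 _] [[e12 _] [e02 _]]] := (tri n01, (tri n12, tri n02)).
have z02 := crossing_gap gC (tri_cross n02).
have z12 := crossing_gap gC (tri_cross n12).
have /andP[m02 l02] := crossing_itv bC e02 y02.
have /andP[m12 l12] := crossing_itv bC e12 y12.
set v := (C (p i0 i2)).1 in lt1 lt2 z02 m02 l02.
set w := (C (p i1 i2)).1 in lt2 z12 m12 l12.
have add x : arc_gap a b C i0 i1 x + arc_gap a b C i1 i2 x =
  arc_gap a b C i0 i2 x by rewrite /arc_gap; ring.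
split.
  have nz : arc_gap a b C i0 i1 v != 0.
    by apply: (gap_neq0 bC gC n01 e01); rewrite ?(ltW m02) ?(ltW l02)// gt_eqF.
  have := gap_before bC gC n12 e12 y12 (v := v); rewrite lt2 (ltW m02).
  move=> /(_ isT); have -> : arc_gap a b C i1 i2 v = - arc_gap a b C i0 i1 v.
    by apply/eqP; rewrite -addr_eq0 addrC add z02.
  have := gap_after bC gC n01 e01 y01 (v := v); rewrite lt1 (ltW l02).
  move=> /(_ isT) <-; rewrite oppr_gt0.
  by case: (ltrgt0P (arc_gap a b C i0 i1 v)) nz => // _ _ /esym/negbRL.
have lt3 := lt_trans lt1 lt2.
have := gap_after bC gC n01 e01 y01 (v := w); rewrite lt3 (ltW l12).
move=> /(_ isT) <-.
have := gap_after bC gC n02 e02 y02 (v := w); rewrite lt2 (ltW l12).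
by move=> /(_ isT) <-; rewrite -add z12 addr0.
Qed.

(* Whether the arcs 0, 1, 2 are met in clockwise cyclic order. *)
Definition tri_cw := ~~ (if a i0 < a i1 then (a i1 < a i2) || ~~ (a i0 < a i2)
  else (a i1 < a i2) && ~~ (a i0 < a i2)).

Lemma tri_chord_eps d0 d1 d2 : cmp_is (p i0 i1) (p i0 i2) d0 ->
  cmp_is (p i1 i0) (p i1 i2) d1 -> cmp_is (p i2 i0) (p i2 i1) d2 ->
  let ox := bsign (lev i1 < lev i0)%N in
  let oy := bsign (lev i2 < lev i1)%N in
  let oz := bsign (lev i0 < lev i2)%N in
  let ka := bsign tri_cw in
  let x := tri_chord i0 i1 in let y := tri_chord i1 i2 in
  let z := tri_chord i2 i0 in
  [/\ eps x y = ka * ox * oy * (d1 == tri_cw)%:R,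
      eps y z = ka * oy * oz * (d2 != tri_cw)%:R,
      eps z x = ka * oz * ox * (d0 != tri_cw)%:R,
      eps y x = - eps x y & eps z y = - eps y z] /\ eps x z = - eps z x.
Proof.
move=> c0 c1 c2 /=.
have [n01 n12 n02] := ord3_neq.
have n10 : i1 != i0 by rewrite eq_sym.
have n21 : i2 != i1 by rewrite eq_sym.
have n20 : i2 != i0 by rewrite eq_sym.
have [[t01 t12] t02] := (tri_itv n01, tri_itv n12, tri_itv n02).
have [[t10 t21] t20] := (tri_itv n10, tri_itv n21, tri_itv n20).
have [sXY sYZ sZX] := tri_sep.
have [e1 e2 e3] := triangle_eps
  (o01 := a i0 < a i1) (o12 := a i1 < a i2) (o02 := a i0 < a i2)
  (p01 := p i0 i1) (p02 := p i0 i2) (p10 := p i1 i0) (p12 := p i1 i2)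
  (p20 := p i2 i0) (p21 := p i2 i1)
  (ltac:(by move=> u v; rewrite !inE => /orP[]/eqP-> /orP[]/eqP->;
    apply: cmp_arcs))
  (ltac:(by move=> u v; rewrite !inE => /orP[]/eqP-> /orP[]/eqP->;
    apply: cmp_arcs))
  (ltac:(by move=> u v; rewrite !inE => /orP[]/eqP-> /orP[]/eqP->;
    apply: cmp_arcs)) c0 c1 c2.
rewrite -/tri_cw in e1 e2 e3.
have o1 := sep_eps (lev i1 < lev i0)%N (lev i2 < lev i1)%N sXY.
have o2 := sep_eps (lev i2 < lev i1)%N (lev i0 < lev i2)%N sYZ.
have o3 := sep_eps (lev i0 < lev i2)%N (lev i1 < lev i0)%N sZX.
split; first split.
- by rewrite /tri_chord o1 e1; ring.
- by rewrite /tri_chord o2 e2; ring.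
- by rewrite /tri_chord o3 e3; ring.
- exact: sep_anti (sep_orient _ _ sXY).
- exact: sep_anti (sep_orient _ _ sYZ).
- exact: sep_anti (sep_orient _ _ sZX).
Qed.

(** Seen from an outer chord, each arc may be shrunk to its starting point. The oriented chords then
    form the closed cycle a 0, a 1, a 2, and [on_right_cycle] says that it separates no two outer
    points. *)
Lemma tri_cocycle e : outer a b e.1 -> outer a b e.2 ->
  bsign (lev i1 < lev i0)%N * eps (tri_chord i0 i1) e +
  bsign (lev i2 < lev i1)%N * eps (tri_chord i1 i2) e +
  bsign (lev i0 < lev i2)%N * eps (tri_chord i2 i0) e = 0.
Proof.
move=> o1 o2; have [n01 n12 n02] := ord3_neq.
have aa i : a i <= a i <= b i by rewrite lexx ltW// (arc_lt bC).
have H i j : i != j -> bsign (lev j < lev i)%N * eps (tri_chord i j) e =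
    eps (a i, a j) e.
  move=> ij; have ji : j != i by rewrite eq_sym.
  have ne z l s : outer a b z -> a l <= s <= b l -> z != s.
    by move=> oz sl; apply: contraPneq (arc_not_outer sl) => <-.
  rewrite /tri_chord eps_orientl.
  - rewrite mulrA (_ : bsign _ * bsign _ = 1) ?mul1r; last by case: (_ < _)%N.
    exact: (eps_arcs (p := (p i j, p j i)) (q := (a i, a j)) bC ij o1 o2
      (tri_itv ij) (aa i) (tri_itv ji) (aa j)).
  - exact: (arcs_disjoint bC ij (tri_itv ij) (tri_itv ji)).2.
  - exact: ne o1 (tri_itv ij).
  - exact: ne o1 (tri_itv ji).
  - exact: ne o2 (tri_itv ij).
  - exact: ne o2 (tri_itv ji).
rewrite !H// 1?eq_sym//.
have dis i j : i != j -> a i != a j.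
  by move=> ij; exact: (arcs_disjoint bC ij (aa i) (aa j)).2.
have no z : outer a b z -> z \notin [:: a i0; a i1; a i2].
  move=> oz; rewrite !inE !negb_or.
  by apply/and3P; split; apply/eqP => e'; apply: (arc_not_outer _ oz);
    rewrite e'; exact: aa.
have := on_right_cycle (dis _ _ n01) (dis _ _ n12) _ (no _ o1) (no _ o2).
rewrite eq_sym dis// => /(_ isT); rewrite /eps.
by do 6 case: on_right.
Qed.

End TriangleChords.

Lemma arc_pair_eps (R : realType) k (a b : 'I_k -> R) (C : diagram R) i j d e
    p q : box_arcs a b C -> i != j -> outer a b e.1 -> outer a b e.2 ->
  a i <= p.1 <= b i -> a i <= q.1 <= b i ->
  a j <= p.2 <= b j -> a j <= q.2 <= b j ->
  eps (orient d p) e = eps (orient d q) e /\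
  eps e (orient d p) = eps e (orient d q).
Proof.
move=> bC ij o1 o2 p1 q1 p2 q2; have ji : j != i by rewrite eq_sym.
case: d => /=; split.
- exact: eps_arcs bC ij o1 o2 p1 q1 p2 q2.
- exact: eps_outer o1 o2 p1 q1 p2 q2.
- exact: (eps_arcs (p := (p.2, p.1)) (q := (q.2, q.1)) bC ji o1 o2 p2 q2 p1 q1).
- exact: (eps_outer (p := (p.2, p.1)) (q := (q.2, q.1)) o1 o2 p2 q2 p1 q1).
Qed.

Lemma bsign_inj d (u v : int) : bsign d * u = bsign d * v -> u = v.
Proof. by case: d; rewrite /bsign ?mul1r // !mulN1r => /oppr_inj. Qed.

(** This ties the sign of each crossing to the intersection bit of the other two chords. Boolean
    [==] and [!=] are parities, so [la] is symmetric in d0, d1, d2; in the third equation the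
    negation of s compensates that of d1 != w. *)
Lemma bsign_cycle (d0 d1 d2 s w : bool) :
  let la := bsign (((d0 == d1) == s) == (d2 != w)) in
  [/\ bsign ((d0 == d1) == s) = la * bsign (d2 != w),
      bsign ((d1 == d2) == s) = la * bsign (d0 != w)
    & bsign ((d2 == d0) == ~~ s) = la * bsign (d1 == w)].
Proof. by case: d0 d1 d2 s w => [] [] [] [] []. Qed.

Lemma H_Omega3 (R : realType) (D D' : diagram R) : Omega3 D D' -> H D = H D'.
Proof.
move=> [a [b [lev [p [q [[rep gD gD'] tp tq xp xq]]]]]].
set i0 := inord 0 in xp xq; set i1 := inord 1 in xp xq.
set i2 := inord 2 in xp xq.
have [bD bD' _] := rep.
have [n01 n12 n02] := ord3_neq; rewrite -/i0 -/i1 -/i2 in n01 n12 n02.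
have n10 : i1 != i0 by rewrite eq_sym.
have n21 : i2 != i1 by rewrite eq_sym.
have n20 : i2 != i0 by rewrite eq_sym.
have /andP[lp1 lp2] := xp; have /andP[lq1 lq2] := xq.
have itvp i j : i != j -> -1 <= (D (p i j)).1 <= 1.
  by move=> ij; exact: (arc_x_itv bD (tri_itv tp ij)).
have itvq i j : i != j -> -1 <= (D' (q i j)).1 <= 1.
  by move=> ij; exact: (arc_x_itv bD' (tri_itv tq ij)).
have norm1 (x : R) : `|x| = 1 -> x = 1 \/ x = -1.
  by move=> /eqP; rewrite eqr_norml => /andP[/orP[]/eqP]; [left|right].
have rep' := box_replacement_sym rep.
have same i j : i != j -> `|(D (p i j)).1| = 1 ->
    (D' (q i j)).1 = (D (p i j)).1.
  by move=> ij; exact: (boundary_same rep gD (tri_cross tp ij) (tq _ _ ij).1).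
have same' i j : i != j -> `|(D' (q i j)).1| = 1 ->
    (D (p i j)).1 = (D' (q i j)).1.
  by move=> ij; exact: (boundary_same rep' gD' (tri_cross tq ij) (tp _ _ ij).1).
have [[/andP[hp1 hp2] /andP[hp3 hp4]] /andP[hp5 hp6]] :=
  (itvp _ _ n01, itvp _ _ n02, itvp _ _ n12).
have [[/andP[hq1 hq2] /andP[hq3 hq4]] /andP[hq5 hq6]] :=
  (itvq _ _ n01, itvq _ _ n02, itvq _ _ n12).
(* A leftmost crossing of D on a side would be on the left one. By [same] it would be there in D'
   too, where this crossing is the rightmost. The other extreme crossings are treated alike, and the
   middle ones lie strictly between. *)
have y01 : `|(D (p i0 i1)).1| != 1.
  by apply/eqP => e; have := same _ _ n01 e; case: (norm1 _ e) => E; lra.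
have y02 : `|(D (p i0 i2)).1| != 1.
  by apply/eqP => e; case: (norm1 _ e) => E; lra.
have y12 : `|(D (p i1 i2)).1| != 1.
  by apply/eqP => e; have := same _ _ n12 e; case: (norm1 _ e) => E; lra.
have y01' : `|(D' (q i0 i1)).1| != 1.
  by apply/eqP => e; have := same' _ _ n01 e; case: (norm1 _ e) => E; lra.
have y02' : `|(D' (q i0 i2)).1| != 1.
  by apply/eqP => e; case: (norm1 _ e) => E; lra.
have y12' : `|(D' (q i1 i2)).1| != 1.
  by apply/eqP => e; have := same' _ _ n12 e; case: (norm1 _ e) => E; lra.
have [dp1 [dp2 dp3]] : (D (p i0 i1)).1 != (D (p i0 i2)).1 /\
    (D (p i0 i2)).1 != (D (p i1 i2)).1 /\ (D (p i0 i1)).1 != (D (p i1 i2)).1.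
  by rewrite !lt_eqF// (lt_trans lp1 lp2).
have [dq1 [dq2 dq3]] : (D' (q i0 i1)).1 != (D' (q i0 i2)).1 /\
    (D' (q i0 i2)).1 != (D' (q i1 i2)).1 /\
    (D' (q i0 i1)).1 != (D' (q i1 i2)).1.
  by rewrite !gt_eqF// (lt_trans lq1 lq2).
have eD := tri_inner_enum bD gD tp dp1 dp2 dp3.
have eD' := tri_inner_enum bD' gD' tq dq1 dq2 dq3.
have [l [[ul lD] [ul' lD'] lo lsgn]] := box_chords_split rep eD eD'.
rewrite -/i0 -/i1 -/i2 in ul lD ul' lD'.
set x := tri_chord lev p i0 i1 in ul lD.
set y := tri_chord lev p i1 i2 in ul lD.
set z := tri_chord lev p i2 i0 in ul lD.
set x' := tri_chord lev q i0 i1 in ul' lD'.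
set y' := tri_chord lev q i1 i2 in ul' lD'.
set z' := tri_chord lev q i2 i0 in ul' lD'.
(* Matches each triangle chord with its successor, so that both sides are weights on one and the
   same list. *)
pose f c := if c == x then x' else if c == y then y' else
  if c == z then z' else c.
move: (ul); rewrite /= !inE !negb_or.
move=> /and4P[/andP[xy /andP[xz xl]] /andP[yz yl] zl _].
have fx : f x = x' by rewrite /f eqxx.
have fy : f y = y' by rewrite /f eq_sym (negbTE xy) eqxx.
have fz : f z = z'.
  by rewrite /f eq_sym (negbTE xz) eq_sym (negbTE yz) eqxx.
have fl e : e \in l -> f e = e.
  move=> el; rewrite /f; case: eqP => [ex|_]; first by rewrite -ex el in xl.
  case: eqP => [ey|_]; first by rewrite -ey el in yl.
  by case: eqP => [ez|//]; rewrite -ez el in zl.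
have mapf : map f ([:: x; y; z] ++ l) = [:: x'; y'; z'] ++ l.
  rewrite /= fx fy fz; congr [:: _, _, _ & _].
  by rewrite -[RHS]map_id; apply/eq_in_map => e /fl.
(* Variables with an equation, rather than local definitions, so that these bits stay opaque. *)
have [d0 ed0] : {d | d = dir a D i0} by exact: (exist _ _ erefl).
have [d1 ed1] : {d | d = dir a D i1} by exact: (exist _ _ erefl).
have [d2 ed2] : {d | d = dir a D i2} by exact: (exist _ _ erefl).
have [cw ecw] : {cw | cw = tri_cw a} by exact: (exist _ _ erefl).
have [g12 g02] := tri_gap_const bD gD tp y01 y12 y02 xp.
rewrite -/i0 -/i1 -/i2 in g12 g02.
have [s0 es0] : {s0 | s0 = (0 < arc_gap a b D i0 i1 1)}
  by exact: (exist _ _ erefl).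
rewrite -es0 in g12 g02.
have y20 : `|(D (p i2 i0)).1| != 1 by rewrite (tri_x tp n02).
have y20' : `|(D' (q i2 i0)).1| != 1 by rewrite (tri_x tq n02).
have g20 : (0 < arc_gap a b D i2 i0 1) = ~~ s0.
  have nz : arc_gap a b D i0 i2 1 != 0.
    apply: (gap_neq0 bD gD n02 (tp _ _ n02).1).
      by rewrite lexx andbT; lra.
    by apply: contraNneq y02 => <-; rewrite normr1.
  have -> : arc_gap a b D i2 i0 1 = - arc_gap a b D i0 i2 1.
    by rewrite /arc_gap opprB.
  by rewrite -g02 -leNgt oppr_gt0 lt_neqAle nz.
have sgnX := tri_sgn bD gD tp n01 y01.
have sgnY := tri_sgn bD gD tp n12 y12.
have sgnZ := tri_sgn bD gD tp n20 y20.
rewrite -ed0 -ed1 -es0 in sgnX; rewrite -ed1 -ed2 g12 in sgnY.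
rewrite -ed2 -ed0 g20 in sgnZ.
have [bX bY bZ] := bsign_cycle d0 d1 d2 s0 cw.
have sgnE i j : i != j -> `|(D (p i j)).1| != 1 -> `|(D' (q i j)).1| != 1 ->
    sgn (gauss D') (tri_chord lev q i j) = sgn (gauss D) (tri_chord lev p i j).
  move=> ij y1 y1'.
  have [e1 e2] := (tri_chord_sgn tp ij, tri_chord_sgn tq ij).
  have e : sgn (gauss D') (q i j, q j i) = sgn (gauss D) (p i j, p j i).
    apply: etrans (tri_sgn bD' gD' tq ij y1') (etrans _ (esym
      (tri_sgn bD gD tp ij y1))).
    by rewrite !(dir_replacement rep gD gD') (gap1_replacement rep gD gD').
  apply: (@bsign_inj (lev j < lev i)%N); exact: etrans e2 (etrans e (esym e1)).
have itv i j (ij : i != j) := tri_itv tp ij.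
have itv' i j (ij : i != j) := tri_itv tq ij.
have c0 : cmp_is (p i0 i1) (p i0 i2) d0.
  rewrite ed0; exact: (cmp_arc gD (itv _ _ n01) (itv _ _ n02) lp1).
have c1 : cmp_is (p i1 i0) (p i1 i2) d1.
  rewrite ed1; apply: (cmp_arc gD (itv _ _ n10) (itv _ _ n12)).
  by rewrite (tri_x tp n01) (lt_trans lp1 lp2).
have c2 : cmp_is (p i2 i0) (p i2 i1) d2.
  rewrite ed2; apply: (cmp_arc gD (itv _ _ n20) (itv _ _ n21)).
  by rewrite (tri_x tp n02) (tri_x tp n12).
(* Directions are kept and the left-right order of the crossings is reversed, so their order in time
   along each arc is reversed. *)
have c0' : cmp_is (q i0 i1) (q i0 i2) (~~ d0).
  apply: cmp_arc_sym; rewrite ed0 -(dir_replacement rep gD gD').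
  exact: (cmp_arc gD' (itv' _ _ n02) (itv' _ _ n01) lq2).
have c1' : cmp_is (q i1 i0) (q i1 i2) (~~ d1).
  apply: cmp_arc_sym; rewrite ed1 -(dir_replacement rep gD gD').
  apply: (cmp_arc gD' (itv' _ _ n12) (itv' _ _ n10)).
  by rewrite (tri_x tq n01) (lt_trans lq1 lq2).
have c2' : cmp_is (q i2 i0) (q i2 i1) (~~ d2).
  apply: cmp_arc_sym; rewrite ed2 -(dir_replacement rep gD gD').
  apply: (cmp_arc gD' (itv' _ _ n21) (itv' _ _ n20)).
  by rewrite (tri_x tq n02) (tri_x tq n12).
have [E1 E2] := tri_chord_eps bD tp dp1 dp2 dp3 c0 c1 c2.
have [E1' E2'] := tri_chord_eps bD' tq dq1 dq2 dq3 c0' c1' c2'.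
have outer_eps i j e : i != j -> e \in l ->
    eps (tri_chord lev q i j) e = eps (tri_chord lev p i j) e /\
    eps e (tri_chord lev q i j) = eps e (tri_chord lev p i j).
  move=> ij /lo[ o1 o2 _ _ _]; have ji : j != i by rewrite eq_sym.
  exact: (arc_pair_eps (p := (q i j, q j i)) (q := (p i j, p j i)) _ bD ij o1 o2
    (itv' _ _ ij) (itv _ _ ij) (itv' _ _ ji) (itv _ _ ji)).
apply: (H_eq ul lD ul' lD') => N; apply: esym.
pose eps' c e := eps (f c) (f e).
apply: (@etrans _ _ (wH (sgn (gauss D)) eps' ([:: x; y; z] ++ l) N)).
  rewrite -mapf; apply: etrans (wH_map f _ N (sgn (gauss D')) (@eps R)) _.
  apply: (@ext_wH _ _ N) => [c|//].
  rewrite mem_cat !inE => /orP[/or3P[]/eqP->|cl].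
  - by rewrite /comp fx; exact: sgnE n01 y01 y01'.
  - by rewrite /comp fy; exact: sgnE n12 y12 y12'.
  - by rewrite /comp fz; exact: sgnE n20 y20 y20'.
  - by rewrite /comp (fl _ cl); exact: lsgn c cl.
rewrite -ecw in E1 E1'.
have bs2 (o : bool) : bsign o ^+ 2 = 1 by case: o.
apply: (@wH_triangle _ l N (sgn (gauss D)) (@eps R) eps' x y z
  (bsign (lev i1 < lev i0)%N) (bsign (lev i2 < lev i1)%N)
  (bsign (lev i0 < lev i2)%N) (bsign cw)
  (bsign (((d0 == d1) == s0) == (d2 != cw)))
  (d1 == cw) (d2 != cw) (d0 != cw)).
- exact: bs2.
- exact: bs2.
- exact: bs2.
- exact: bs2.
- apply: etrans (tri_chord_sgn tp n01) _; exact: etrans sgnX bX.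
- apply: etrans (tri_chord_sgn tp n12) _; exact: etrans sgnY bY.
- apply: etrans (tri_chord_sgn tp n20) _; exact: etrans sgnZ bZ.
- by split; exact: eps_self.
- exact: eps_self.
- exact: E1.
- exact: E2.
- rewrite /eps' fx fy fz; move: E1'; rewrite -/x' -/y' -/z'.
  have nn (o o' : bool) : (~~ o == o') = ~~ (o == o') by case: o; case: o'.
  by rewrite (nn d0) (nn d1) (nn d2).
- by rewrite /eps' fx fz; exact: E2'.
- by move=> e /lo[ o1 o2 _ _ _]; exact: (tri_cocycle bD tp o1 o2).
- move=> e el; rewrite /eps' fx fy fz (fl _ el); split.
  + exact: (outer_eps _ _ _ n01 el).1.
  + exact: (outer_eps _ _ _ n12 el).1.
  + exact: (outer_eps _ _ _ n20 el).1.
- move=> e c el; rewrite !inE /eps' (fl _ el) => /or4P[/eqP->|/eqP->|/eqP->|cl].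
  + by rewrite fx; exact: (outer_eps _ _ _ n01 el).2.
  + by rewrite fy; exact: (outer_eps _ _ _ n12 el).2.
  + by rewrite fz; exact: (outer_eps _ _ _ n20 el).2.
  + by rewrite (fl _ cl).
Qed.

Theorem theorem1p1 (R : realType) (D D' : diagram R) :
  knotoid_equiv D D' -> H D = H D'.
Proof.
elim=> {D D'} [D D' [DD'|DD'|DD'|DD']|//|D D' _ e|D D' D'' _ e _ e'].
- exact: H_planar_isotopic DD'.
- exact: H_Omega1 DD'.
- exact: H_Omega2 DD'.
- exact: H_Omega3 DD'.
- exact: esym e.
- exact: (etrans e e').
Qed.
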